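(* There exist constants $D>0$ and $C>0$ (numerical, depending only on $\gamma$) such that for all $J\subset\{1,\dots,N\}$ with $d:=d(J)=\mathrm{card}(J)$, for all $A\ge1$ and for all $$\varepsilon\ge D\sqrt{\frac{d+A\log N}{n}},$$ the following bounds hold with probability at least $1-N^{-A}$: $$\sum_{j\notin J}\hat\lambda^\varepsilon_j\le C\Bigl[\sum_{j\notin J}\lambda^\varepsilon_j+M^2\sqrt{\frac{d+A\log N}{n}}\Bigr],\qquad \sum_{j\notin J}\lambda^\varepsilon_j\le C\Bigl[\sum_{j\notin J}\hat\lambda^\varepsilon_j+M^2\sqrt{\frac{d+A\log N}{n}}\Bigr]$$ and $$\|f_{\hat\lambda^\varepsilon}-f_{\lambda^\varepsilon}\|^2_{L_2(\mu)}+\varepsilon K(\hat\lambda^\varepsilon,\lambda^\varepsilon)\le C\Bigl[M^2\,\frac{d+A\log N}{n}\vee\Bigl(\sum_{j\notin J}\lambda^\varepsilon_j\Bigr)\sqrt{\frac{d+A\log N}{n}}\Bigr].$$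
   Context: Density estimation setting. $X_1,\dots,X_n$ are i.i.d. random variables in a measurable space $(S,\mathcal A)$ with common distribution $P$, and $P_n$ is their empirical distribution; $Pg=\mathbb E g(X_1)$, $P_ng=n^{-1}\sum_{i=1}^ng(X_i)$. $P$ has a density $f_*$ with respect to a $\sigma$-finite measure $\mu$ on $(S,\mathcal A)$, and $f_*$ is uniformly bounded by a constant $M$. The dictionary $h_1,\dots,h_N$ consists of probability densities with respect to $\mu$ that are uniformly bounded by $1$. $\Lambda=\{(\lambda_1,\dots,\lambda_N):\lambda_j\ge0,\ \sum_{j=1}^N\lambda_j=1\}$ and $f_\lambda=\sum_{j=1}^N\lambda_jh_j$. Estimators. For a regularization parameter $\varepsilon$ (with $0\log0=0$), $$\hat\lambda^\varepsilon:=\operatorname*{argmin}_{\lambda\in\Lambda}\Bigl[\|f_\lambda\|^2_{L_2(\mu)}-2P_nf_\lambda+\varepsilon\sum_{j=1}^N\lambda_j\log\lambda_j\Bigr],\qquad \lambda^\varepsilon:=\operatorname*{argmin}_{\lambda\in\Lambda}\Bigl[\|f_\lambda\|^2_{L_2(\mu)}-2Pf_\lambda+\varepsilon\sum_{j=1}^N\lambda_j\log\lambda_j\Bigr].$$ For $\lambda,\nu\in\Lambda$, $K(\lambda|\nu):=\sum_{j=1}^N\lambda_j\log(\lambda_j/\nu_j)$ and $K(\lambda,\nu):=K(\lambda|\nu)+K(\nu|\lambda)$. $a\vee b=\max(a,b)$. Standing assumption: $N\ge(\log n)^\gamma$ for some fixed $\gamma>0$.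
   Formalization: The bound M on the density f_* is additionally assumed to satisfy M ≥ 1; for M tending to 0 the stated bounds with M² and constants depending only on γ fail (e.g. n = 1, N = 2, f_* = M on [0,1/M], h_1, h_2 indicators of [0,1], [1,2], A = 2 log_2(1/M)). *)

(* Defs.v *)
From HB Require Import structures.
From mathcomp Require Import all_boot all_order all_algebra.
From mathcomp Require Import all_classical all_reals all_analysis.
Set Implicit Arguments.
Unset Strict Implicit.
Unset Printing Implicit Defensive.
Import Order.TTheory GRing.Theory Num.Theory.
Import numFieldNormedType.Exports.
Local Open Scope classical_set_scope.
Local Open Scope ring_scope.

Section Probability.
Context (R : realType) (d d' : measure_display).
Context (Omega : measurableType d) (S : measurableType d').
Variable Pr : probability Omega R.

(* Since setT is a possible value of each B i, the product rule over the whole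
   finite family covers all its subfamilies. *)
Definition mutually_independent (n : nat) (X : 'I_n -> {mfun Omega >-> S}) :=
  forall B : 'I_n -> set S, (forall i, measurable (B i)) ->
    Pr [set w | forall i, B i (X i w)] = (\prod_(i < n) Pr (X i @^-1` B i))%E.

Definition iid_sample (P : probability S R) (n : nat)
    (X : 'I_n -> {mfun Omega >-> S}) :=
  (forall i B, measurable B -> distribution Pr (X i) B = P B) /\
  mutually_independent X.

(* The set of w satisfying Q is not required to be measurable, only to contain
   a measurable event of probability at least p; when that set is measurable
   this is p <= Pr [set w | Q w]. *)
Definition holds_with_prob_ge (p : R) (Q : Omega -> Prop) :=
  exists E : set Omega,
    [/\ measurable E, (p%:E <= Pr E)%E & forall w, E w -> Q w].

End Probability.

Section Densities.
Context (R : realType) (d : measure_display) (S : measurableType d).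
Variable mu : {sigma_finite_measure set S -> \bar R}.

Definition probability_density (f : S -> R) :=
  [/\ measurable_fun setT f, forall x, 0 <= f x
    & (\int[mu]_x (f x)%:E = 1)%E].

Definition has_density (P : probability S R) (f : S -> R) :=
  probability_density f /\
  forall B, measurable B -> P B = (\int[mu]_(x in B) (f x)%:E)%E.

(* [fine] is harmless on square-integrable functions, in particular on linear
   combinations of bounded densities. *)
Definition L2norm (f : S -> R) : R := fine 'N[mu]_(2%:E)[EFin \o f]%E.

End Densities.

Section Functionals.
Context (R : realType) (d d' : measure_display).
Context (Omega : measurableType d) (S : measurableType d').

Definition mean (P : probability S R) (g : S -> R) : R := Rintegral P setT g.

Definition empirical_mean (n : nat) (X : 'I_n -> {mfun Omega >-> S})
    (w : Omega) (g : S -> R) : R :=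
  n%:R^-1 * \sum_(i < n) g (X i w).

End Functionals.

Section Simplex.
Context (R : realType) (N : nat).

Definition simplex : set ('I_N -> R) :=
  [set l | (forall j, 0 <= l j) /\ \sum_(j < N) l j = 1].

Definition mixture (T : Type) (h : 'I_N -> T -> R) (l : 'I_N -> R) : T -> R :=
  fun x => \sum_(j < N) l j * h j x.

(* 0 log 0 = 0 holds because of the factor 0, whatever the value of ln 0. *)
Definition negentropy (l : 'I_N -> R) : R := \sum_(j < N) l j * ln (l j).

(* K(l | m), extended-real valued, with the usual conventions
   0 log (0 / m_j) = 0 and l_j log (l_j / 0) = +oo for l_j > 0. *)
Definition KL (l m : 'I_N -> R) : \bar R :=
  (\sum_(j < N)
    if (l j == 0)%R then 0
    else if (m j == 0)%R then +oo
    else (l j * ln (l j / m j))%:E)%E.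

Definition symKL (l m : 'I_N -> R) : \bar R := (KL l m + KL m l)%E.

End Simplex.

Arguments simplex : clear implicits.

Definition argmin_on (R : realType) (T : Type) (A : set T) (F : T -> R) : set T :=
  [set x | A x /\ forall y, A y -> F x <= F y].

Section PenalizedRisk.
Context (R : realType) (d : measure_display) (S : measurableType d).
Variables (mu : {sigma_finite_measure set S -> \bar R}) (N : nat).

(* [E] is the linear functional g |-> P g (true risk) or g |-> P_n g
   (empirical risk). *)
Definition penalized_risk (h : 'I_N -> S -> R) (E : (S -> R) -> R) (eps : R)
    (l : 'I_N -> R) : R :=
  L2norm mu (mixture h l) ^+ 2 - 2 * E (mixture h l) + eps * negentropy l.

End PenalizedRisk.

(* Main.v *)
(* Adding the first-order optimality conditions of the two minimizers a (empirical)
   and b (true) gives, for u = a - b,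
     |f_u|^2 + (eps / 2) K(a, b) <= (P_n - P) f_u.
   The right-hand side is at most, uniformly in u with |u|_1 <= 2,
     c sqrt r sum_{j notin J} |u_j| + |f_u|^2 / 2 + C M^2 r,
   and since |a_j - b_j| <= b_j + 2 (a_j - b_j) ln (a_j / b_j) the first term is
   absorbed by (eps / 2) K(a, b) up to sum_{j notin J} b_j.

   For the coordinates outside J, each (P_n - P) h_j is bounded by a Chernoff bound.
   For those in J, the bound (P_n - P) f_v <= C (s sqrt r + r) when P f_v^2 <= s^2
   avoids concentration inequalities for suprema: if G is the symmetric convex body
   {|v|_1 <= 2, P f_v^2 <= s^2} of R^J, then Jensen's inequality on v + G bounds
   exp (l n (P_n - P) f_v) by the average of exp (l n (P_n - P) f_w) over w in 2 G,
   times the volume ratio 4^|J|.  Volumes are replaced by numbers of points of a fine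
   lattice, and a dyadic union bound over s costs a factor log n <= N^(1/gamma). *)

Require Import Defs.
From mathcomp Require Import all_boot all_order all_algebra.
From mathcomp Require Import all_classical all_reals all_analysis.
From mathcomp Require Import finmap measurable_realfun zify lra ring.
Import Order.TTheory GRing.Theory Num.Theory.
Import numFieldNormedType.Exports.
Local Open Scope classical_set_scope.
Local Open Scope ring_scope.
Set Implicit Arguments.
Unset Strict Implicit.
Unset Printing Implicit Defensive.

(** * Integration against weights and independence *)

Section WeightedTransfer.
Context (R : realType) d1 d2 (T1 : measurableType d1) (T2 : measurableType d2).
Variables (m1 : {measure set T1 -> \bar R}) (m2 : {measure set T2 -> \bar R}).
Variables (X : T1 -> T2) (Y : T1 -> R) (c : R).
Hypotheses (mX : measurable_fun setT X) (mY : measurable_fun setT Y).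
Hypotheses (Y0 : forall x, 0 <= Y x) (c0 : 0 <= c).
Hypothesis XY_le : forall B, measurable B ->
  (\int[m1]_x (Y x * \1_B (X x))%:E <= c%:E * m2 B)%E.

Import HBNNSimple.

Let mYX (g : T2 -> R) : measurable_fun setT g ->
  measurable_fun setT (fun x => (Y x * g (X x))%:E).
Proof.
by move=> mg; apply/measurable_EFinP/measurable_funM => //; apply: (measurableT_comp mg).
Qed.

Let le_integral_nnsfun (g : {nnsfun T2 >-> R}) :
  (\int[m1]_x (Y x * g (X x))%:E <= c%:E * \int[m2]_x (g x)%:E)%E.
Proof.
have r0 r : range g r -> 0 <= r by case=> y _ <-.
have gE x : g x = \sum_(r <- fset_set (range g)) r * \1_(g @^-1` [set r]) x.
  by rewrite fimfunE fsbig_finite.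
have -> : (\int[m2]_x (g x)%:E =
    \sum_(r <- fset_set (range g)) r%:E * m2 (g @^-1` [set r]))%E.
  by rewrite integralT_nnsfun sintegralE fsbig_finite.
have -> : (\int[m1]_x (Y x * g (X x))%:E = \sum_(r <- fset_set (range g))
    r%:E * \int[m1]_x (Y x * \1_(g @^-1` [set r]) (X x))%:E)%E.
  (* The absolute value makes the summand non-negative for every [r], as termwise integration
     requires; on the range of [g] it changes nothing. *)
  transitivity (\int[m1]_x (\sum_(r <- fset_set (range g))
      (`|r|%:E * (Y x * \1_(g @^-1` [set r]) (X x))%:E)))%E.
    apply: eq_integral => x _; rewrite gE mulr_sumr -sumEFin.
    apply: eq_big_seq => r; rewrite in_fset_set// in_setE => /r0 r_ge0.
    by rewrite ger0_norm// -EFinM mulrCA.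
  rewrite ge0_integral_sum//.
  - apply: eq_big_seq => r; rewrite in_fset_set// in_setE => /r0 r_ge0.
    rewrite ger0_norm// ge0_integralZl_EFin//.
    - by move=> x _; rewrite lee_fin mulr_ge0.
    - exact: mYX.
  - by move=> r; apply: measurable_funeM; exact: mYX.
  - by move=> r x _; rewrite -EFinM lee_fin !mulr_ge0.
rewrite [in leRHS]big_seq ge0_sume_distrr; last first.
  by move=> r; rewrite in_fset_set// in_setE => /r0 r_ge0; rewrite mule_ge0// lee_fin.
rewrite big_seq; apply: lee_sum => r.
rewrite in_fset_set// in_setE => /r0 r_ge0.
by rewrite muleCA lee_wpmul2l ?lee_fin// XY_le.
Qed.

(** The hypothesis [XY_le] is the case of indicators; linearity gives simple functions and monotone
    convergence the rest. It serves to change one factor of an independent product and to compare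
    [P] with [M mu]. *)
Lemma le_integral_comp_weight (phi : T2 -> R) :
  measurable_fun setT phi -> (forall x, 0 <= phi x) ->
  (\int[m1]_x (Y x * phi (X x))%:E <= c%:E * \int[m2]_x (phi x)%:E)%E.
Proof.
move=> mphi phi0.
have mEphi : measurable_fun setT (EFin \o phi) by exact/measurable_EFinP.
pose g := nnsfun_approx measurableT mEphi.
have g_cvg y : EFin \o g^~ y @ \oo --> (phi y)%:E.
  by apply: (cvg_nnsfun_approx measurableT mEphi) => // z _; rewrite lee_fin.
have g_nd y : {homo g^~ y : m n / (m <= n)%N >-> m <= n}.
  by move=> m n mn; exact/lefP/nd_nnsfun_approx.
have g_le n y : g n y <= phi y.
  rewrite -lee_fin.
  have /cvg_lim <- // := g_cvg y.
  have /ereal_nondecreasing_cvgn/cvg_lim -> // : nondecreasing_seq (EFin \o g^~ y).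
    by move=> m k mk; rewrite /= lee_fin g_nd.
  by apply: ereal_sup_ubound; exists n.
have -> : (\int[m1]_x (Y x * phi (X x))%:E =
    limn (fun n => \int[m1]_x (Y x * g n (X x))%:E))%E.
  rewrite -monotone_convergence//.
  - apply: eq_integral => x _; apply/esym/cvg_lim => //.
    under eq_fun do rewrite EFinM.
    by rewrite EFinM; apply: cvgeZl => //; exact: g_cvg.
  - by move=> n; exact: mYX.
  - by move=> n x _; rewrite lee_fin mulr_ge0.
  - by move=> x _ m n mn; rewrite lee_fin ler_wpM2l// g_nd.
apply: lime_le.
  apply: ereal_nondecreasing_is_cvgn => m n mn; apply: ge0_le_integral => //.
  - by move=> x _; rewrite lee_fin mulr_ge0.
  - exact: mYX.
  - exact: mYX.
  - by move=> x _; rewrite lee_fin ler_wpM2l// g_nd.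
apply: nearW => n; apply: (le_trans (le_integral_nnsfun (g n))).
rewrite lee_wpmul2l ?lee_fin//; apply: ge0_le_integral => //.
- by move=> x _; rewrite lee_fin.
- exact/measurable_EFinP.
- by move=> x _; rewrite lee_fin.
Qed.

End WeightedTransfer.

(** From [exp (- x) >= 1 - x] one gets [exp x <= 1 / (1 - x)], and [(1 - x) (1 + x + 2 x^2) = 1 +
    x^2 (1 - 2 x)] is at least 1. *)
Lemma expR_le_quadratic (R : realType) (x : R) :
  x <= 1 / 2 -> expR x <= 1 + x + 2 * x ^+ 2.
Proof.
move=> x_le; have x1 : 0 < 1 - x by lra.
have exp_le : expR x <= (1 - x)^-1.
  by rewrite -[x in expR x]opprK expRN lef_pV2 ?posrE ?expR_gt0// expR_ge1Dx.
apply: (le_trans exp_le); rewrite -(@ler_pM2r _ (1 - x))// mulVf ?gt_eqF//.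
have : 0 <= x ^+ 2 * (1 - 2 * x) by rewrite mulr_ge0 ?sqr_ge0//; lra.
by nra.
Qed.

(** * Bounded measurable functions, their means and exponential moments *)

Section BoundedMeasurable.
Context (R : realType) d (S : measurableType d).
Implicit Types f g : S -> R.

Definition bounded_measurable f :=
  measurable_fun setT f /\ exists K, forall x, `|f x| <= K.

Lemma bounded_measurable_cst (c : R) : bounded_measurable (fun=> c).
Proof. by split => //; exists `|c|. Qed.

Lemma bounded_measurableD f g :
  bounded_measurable f -> bounded_measurable g -> bounded_measurable (fun x => f x + g x).
Proof.
move=> [mf [K fK]] [mg [L gL]]; split; first exact: measurable_funD.
by exists (K + L) => x; rewrite (le_trans (ler_normD _ _))// lerD.
Qed.

Lemma bounded_measurableM f g :
  bounded_measurable f -> bounded_measurable g -> bounded_measurable (fun x => f x * g x).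
Proof.
move=> [mf [K fK]] [mg [L gL]]; split; first exact: measurable_funM.
by exists (K * L) => x; rewrite normrM ler_pM.
Qed.

Lemma bounded_measurableZ (c : R) f :
  bounded_measurable f -> bounded_measurable (fun x => c * f x).
Proof. exact/bounded_measurableM/bounded_measurable_cst. Qed.

Lemma bounded_measurableX f n :
  bounded_measurable f -> bounded_measurable (fun x => f x ^+ n).
Proof.
move=> [mf [K fK]]; split; first exact: measurable_funX.
by exists (K ^+ n) => x; rewrite normrX lerXn2r// nnegrE ?(le_trans _ (fK x)).
Qed.

Lemma bounded_measurable_sum I (s : seq I) (F : I -> S -> R) :
  (forall i, bounded_measurable (F i)) ->
  bounded_measurable (fun x => \sum_(i <- s) F i x).
Proof.
move=> bF; elim: s => [|i s ih].
  by under eq_fun do rewrite big_nil; exact: bounded_measurable_cst.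
by under eq_fun do rewrite big_cons; exact: bounded_measurableD.
Qed.

End BoundedMeasurable.

Section Mean.
Context (R : realType) d (S : measurableType d) (P : probability S R).
Implicit Types f g : S -> R.

Lemma bounded_measurable_integrable f :
  bounded_measurable f -> P.-integrable setT (EFin \o f).
Proof.
move=> [mf [K fK]]; apply: measurable_bounded_integrable => //.
  by apply: (le_lt_trans (probability_le1 P measurableT)); rewrite ltry.
by exists K; split; [exact: num_real|move=> M KM x _; exact: le_trans (fK x) (ltW KM)].
Qed.

Lemma mean_EFin f : bounded_measurable f -> (\int[P]_x (f x)%:E = (mean P f)%:E)%E.
Proof.
move=> bf; rewrite /mean /Rintegral fineK//.
by apply: integrable_fin_num => //; exact: bounded_measurable_integrable.
Qed.

Lemma mean_cst (c : R) : mean P (fun=> c) = c.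
Proof.
transitivity (c * fine (P setT)); first exact: Rintegral_cst.
by rewrite probability_setT mulr1.
Qed.

Lemma meanD f g : bounded_measurable f -> bounded_measurable g ->
  mean P (fun x => f x + g x) = mean P f + mean P g.
Proof. by move=> bf bg; rewrite /mean RintegralD//; exact: bounded_measurable_integrable. Qed.

Lemma meanZ (c : R) f : bounded_measurable f ->
  mean P (fun x => c * f x) = c * mean P f.
Proof. by move=> bf; rewrite /mean RintegralZl//; exact: bounded_measurable_integrable. Qed.

Lemma mean_sum I (s : seq I) (F : I -> S -> R) :
  (forall i, bounded_measurable (F i)) ->
  mean P (fun x => \sum_(i <- s) F i x) = \sum_(i <- s) mean P (F i).
Proof.
move=> bF; elim: s => [|i s ih].
  by under eq_fun do rewrite big_nil; rewrite big_nil mean_cst.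
under eq_fun do rewrite big_cons.
by rewrite big_cons meanD ?ih//; exact: bounded_measurable_sum.
Qed.

Lemma mean_le f g : bounded_measurable f -> bounded_measurable g ->
  (forall x, f x <= g x) -> mean P f <= mean P g.
Proof.
by move=> bf bg fg; apply: le_Rintegral => //; exact: bounded_measurable_integrable.
Qed.

(** Since [f - P f <= 8] and [l <= 1 / 16], the exponent is at most [1 / 2] and the quadratic bound
    applies. Its linear term has mean zero and the variance is at most [P f^2]. The bound 4 on [f]
    is the l1 radius of the doubled body [2 G]. *)
Lemma exp_moment_le f (l Q : R) :
  measurable_fun setT f -> (forall x, `|f x| <= 4) -> 0 <= l -> l <= 1 / 16 ->
  mean P (fun x => f x ^+ 2) <= Q ->
  (\int[P]_x (expR (l * (f x - mean P f)))%:E <= (expR (2 * l ^+ 2 * Q))%:E)%E.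
Proof.
move=> mf f4 l0 l16 fQ; set m := mean P f.
have bf : bounded_measurable f by split => //; exists 4.
have bf2 : bounded_measurable (fun x => f x ^+ 2) by exact: bounded_measurableX.
have m4 : -4 <= m <= 4.
  have f_itv x : -4 <= f x <= 4 by rewrite -ler_norml.
  have bc c : bounded_measurable (fun=> c : R) by exact: bounded_measurable_cst.
  apply/andP; split; [rewrite -(mean_cst (-4))|rewrite -(mean_cst 4)]; apply: mean_le => // x.
    by case/andP: (f_itv x).
  by case/andP: (f_itv x).
pose a : R := 1 - l * m + 2 * l ^+ 2 * m ^+ 2.
pose b : R := l - 4 * l ^+ 2 * m.
pose c : R := 2 * l ^+ 2.
have exp_le x : expR (l * (f x - m)) <= a + b * f x + c * f x ^+ 2.
  have y_le : l * (f x - m) <= 1 / 2.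
    have := f4 x; have := m4; rewrite !ler_norml => /andP[? ?] /andP[? ?].
    have : f x - m <= 8 by lra.
    by nra.
  by apply: (le_trans (expR_le_quadratic y_le)); rewrite /a /b /c; nra.
have bl : bounded_measurable (fun x => a + b * f x).
  by apply: bounded_measurableD; [exact: bounded_measurable_cst|exact: bounded_measurableZ].
pose q x : R := a + b * f x + c * f x ^+ 2.
have bq : bounded_measurable q.
  by apply: bounded_measurableD => //; exact: bounded_measurableZ.
apply: (@le_trans _ _ (\int[P]_x (q x)%:E)%E).
  apply: ge0_le_integral => //.
  - apply/measurable_EFinP/measurableT_comp => //.
    by apply: measurable_funM => //; apply: measurable_funB.
  - by apply/measurable_EFinP; case: bq.
  - by move=> x _; rewrite lee_fin exp_le.
rewrite (mean_EFin bq) lee_fin.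
have -> : mean P q = a + b * m + c * mean P (fun x => f x ^+ 2).
  rewrite (meanD bl (bounded_measurableZ c bf2)) meanZ//; congr (_ + _).
  rewrite (meanD (bounded_measurable_cst _ a) (bounded_measurableZ b bf)) meanZ//.
  by rewrite mean_cst.
rewrite (le_trans _ (expR_ge1Dx _))// /a /b /c.
have -> : 1 - l * m + 2 * l ^+ 2 * m ^+ 2 + (l - 4 * l ^+ 2 * m) * m +
    2 * l ^+ 2 * mean P (fun x => f x ^+ 2) =
  1 + 2 * l ^+ 2 * mean P (fun x => f x ^+ 2) - 2 * (l * m) ^+ 2 by ring.
have : 2 * l ^+ 2 * mean P (fun x => f x ^+ 2) <= 2 * l ^+ 2 * Q.
  by rewrite ler_wpM2l// mulr_ge0// sqr_ge0.
by have := sqr_ge0 (l * m); lra.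
Qed.

End Mean.

Section Independence.
Context (R : realType) dO dS (Omega : measurableType dO) (S : measurableType dS).
Context (Pr : probability Omega R) (P : probability S R) (n : nat).
Variable X : 'I_n -> {mfun Omega >-> S}.
Hypothesis iidX : iid_sample Pr P X.

Lemma iid_expectation_prod_le (phi : 'I_n -> S -> R) (C : 'I_n -> R) :
  (forall i, measurable_fun setT (phi i)) -> (forall i x, 0 <= phi i x) ->
  (forall i, 0 <= C i) -> (forall i, \int[P]_x (phi i x)%:E <= (C i)%:E)%E ->
  (\int[Pr]_w (\prod_(i < n) phi i (X i w))%:E <= (\prod_(i < n) C i)%:E)%E.
Proof.
move=> mphi phi0 C0 phiC.
(* Replace the indicators in the product rule by the [phi i] one at a time. *)
pose psi (k : nat) (B : 'I_n -> set S) (i : 'I_n) : S -> R :=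
  if (i < k)%N then phi i else \1_(B i).
pose D (k : nat) (B : 'I_n -> set S) (i : 'I_n) : R :=
  if (i < k)%N then C i else fine (P (B i)).
have mpsi k B i : (forall j, measurable (B j)) -> measurable_fun setT (psi k B i).
  by move=> mB; rewrite /psi; case: ifP.
have psi0 k B i x : 0 <= psi k B i x by rewrite /psi; case: ifP.
have D0 k B i : 0 <= D k B i by rewrite /D; case: ifP => // _; exact: fine_ge0.
suff main k : (k <= n)%N -> forall B, (forall i, measurable (B i)) ->
    (\int[Pr]_w (\prod_(i < n) psi k B i (X i w))%:E <= (\prod_(i < n) D k B i)%:E)%E.
  have /(_ (fun=> setT)) := main n (leqnn n).
  have psiE B i : psi n B i = phi i by rewrite /psi ltn_ord.
  have DE B i : D n B i = C i by rewrite /D ltn_ord.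
  under eq_integral do under eq_bigr do rewrite psiE.
  by under [in X in _ -> X]eq_bigr do rewrite -(DE (fun=> setT)); apply.
elim: k => [_ B mB|k ih kn B mB].
  have [Xdist Xind] := iidX.
  rewrite (eq_integral (fun w => (\1_[set w | forall i, B i (X i w)] w)%:E)); last first.
    move=> w _; congr EFin; rewrite indicE.
    have [Bw|nBw] := pselect (forall i, B i (X i w)).
      rewrite mem_set//= big1// => i _; rewrite /psi /= indicE mem_set//.
    rewrite memNset//=; have /existsNP[i nBi] := nBw.
    by rewrite (bigD1 i)//= /psi /= indicE memNset// mul0r.
  have mE : measurable [set w | forall i, B i (X i w)].
    rewrite (_ : [set w | _] = \bigcap_(i in [set: 'I_n]) (X i @^-1` B i)).
      apply: fin_bigcap_measurable => // i _.
      by rewrite -[_ @^-1` _]setTI; exact: measurable_funPT.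
    by apply/seteqP; split => w Bw i //=; exact: Bw.
  rewrite (integral_indic _ measurableT)// setIT.
  suff: (Pr [set w | forall i, B i (X i w)] <= (\prod_(i < n) D 0%N B i)%:E)%E by [].
  rewrite (Xind B mB) -prodEFin.
  rewrite (eq_bigr (fun i => (D 0%N B i)%:E))// => i _.
  by rewrite /D fineK ?fin_num_measure// -(Xdist i _ (mB i)).
pose i0 := Ordinal kn.
rewrite (bigD1 i0)//= [D _ _ _](_ : _ = C i0); last by rewrite /D /= ltnS leqnn.
under eq_integral do rewrite (bigD1 i0)//= mulrC.
have psi_i0 : psi k.+1 B i0 = phi i0 by rewrite /psi /= ltnS leqnn.
rewrite psi_i0 mulrC.
set c := \prod_(i < n | i != i0) _.
have c0 : 0 <= c by rewrite prodr_ge0.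
have mX i : measurable_fun setT (X i) by exact: measurable_funPT.
apply: (@le_trans _ _ (c%:E * \int[P]_x (phi i0 x)%:E)%E); last first.
  by rewrite EFinM lee_wpmul2l// lee_fin.
apply: (le_integral_comp_weight (X := X i0)
  (Y := fun w => \prod_(i < n | i != i0) psi k.+1 B i (X i w))) => //.
- rewrite (_ : (fun w => _) = (fun w => \prod_(i <- [seq i <- index_enum 'I_n | i != i0])
      psi k.+1 B i (X i w))); last by apply/funext => w; rewrite big_filter.
  by apply: measurable_prod => i _; exact: measurableT_comp (mpsi _ _ _ mB) (mX i).
- by move=> w; rewrite prodr_ge0.
(* With the product of the other factors as weight, only an indicator at [i0] has to be treated;
   putting [B'] in place of [B i0] turns this case into the induction hypothesis. *)
move=> B' mB'; pose B'' i := if i == i0 then B' else B i.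
have mB'' i : measurable (B'' i) by rewrite /B''; case: ifP.
have neq_lt i : i != i0 -> (i < k.+1)%N = (i < k)%N.
  by move=> ii0; rewrite ltnS leq_eqVlt -[k]/(val i0) val_eqE (negbTE ii0).
have := ih (ltnW kn) B'' mB''; rewrite [in leRHS](bigD1 i0)//=.
under eq_integral do rewrite (bigD1 i0)//= mulrC.
have -> : psi k B'' i0 = \1_B' by rewrite /psi /B'' ltnn eqxx.
have -> : D k B'' i0 = fine (P B') by rewrite /D /B'' ltnn eqxx.
rewrite mulrC EFinM fineK ?fin_num_measure//.
have -> : \prod_(i < n | i != i0) D k B'' i = c.
  by apply: eq_bigr => i ii0; rewrite /D /B'' neq_lt// (negbTE ii0).
under eq_integral => w _.
  rewrite (eq_bigr (fun i => psi k.+1 B i (X i w))); last first.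
    by move=> i ii0; rewrite /psi /B'' neq_lt// (negbTE ii0).
  over.
by [].
Qed.

End Independence.

(** Markov's inequality is applied once, to the sum of the family: its mean is at most [#|I|] and,
    by non-negativity, it dominates every member. *)
Lemma finite_family_markov (R : realType) d (Omega : measurableType d)
    (Pr : probability Omega R) (I : finType) (Y : I -> Omega -> R) (T : R) :
  (0 < #|I|)%N -> 0 < T -> (forall i, measurable_fun setT (Y i)) ->
  (forall i w, 0 <= Y i w) -> (forall i, \int[Pr]_w (Y i w)%:E <= 1)%E ->
  holds_with_prob_ge Pr (1 - T^-1) (fun w => forall i, Y i w <= T * #|I|%:R).
Proof.
move=> I0 T0 mY Y0 EY.
pose Z w := \sum_i Y i w; pose a := T * #|I|%:R.
have a0 : 0 < a by rewrite mulr_gt0// ltr0n.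
have mZ : measurable_fun setT Z by exact: measurable_sum.
pose A := [set w | a <= Z w].
have mA : measurable A.
  by rewrite -[X in measurable X]setTI; exact: measurable_fun_le.
exists (~` A); split; first exact: measurableC.
  rewrite probability_setC// EFinB leeB// -(@lee_pmul2l _ a%:E)//.
  rewrite -EFinM (_ : a * T^-1 = #|I|%:R); last by rewrite /a mulrAC divff ?mul1r ?gt_eqF.
  have -> : (a%:E * Pr A = \int[Pr]_w (a * \1_A w)%:E)%E.
    under eq_integral do rewrite EFinM.
    by rewrite ge0_integralZl_EFin ?ltW// ?integral_indic ?setIT//; exact/measurable_EFinP.
  apply: (@le_trans _ _ (\int[Pr]_w (Z w)%:E)%E).
    apply: ge0_le_integral => //.
    - by move=> w _; rewrite lee_fin mulr_ge0// ltW.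
    - by apply/measurable_EFinP/measurable_funM.
    - exact/measurable_EFinP.
    move=> w _; rewrite lee_fin indicE; have [aZ|aZ] := boolP (a <= Z w).
      by rewrite mem_set ?mulr1.
    rewrite memNset ?mulr0 ?sumr_ge0//; exact/negP.
  rewrite /Z; under eq_integral do rewrite -sumEFin.
  rewrite ge0_integral_sum//; last 2 first.
  - by move=> i; exact/measurable_EFinP.
  - by move=> i w _; rewrite lee_fin.
  apply: (@le_trans _ _ (\sum_(i : I) 1%E)); first exact: lee_sum.
  by rewrite sumEFin sumr_const.
move=> w nAw i; have Zw : Z w < a by rewrite ltNge; apply/negP.
by rewrite (le_trans _ (ltW Zw))// /Z (bigD1 i)//= lerDl sumr_ge0.
Qed.

(** * Lattice points of symmetric convex bodies *)

Section LatticePoints.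
Context (N : nat).
Local Notation V := {ffun 'I_N -> int}.

(** A finite list containing all lattice points of a bounded body, so that the body can be
    enumerated by filtering it. Coordinates are shifted by [m] to become ordinals. *)
Lemma lattice_box (m : nat) :
  exists2 s : seq V, uniq s & forall x, (x \in s) = [forall j, `|x j| <= m%:Z].
Proof.
pose emb (f : {ffun 'I_N -> 'I_((m + m).+1)}) : V := [ffun j => (f j : nat)%:Z - m%:Z].
exists (undup [seq emb f | f : {ffun 'I_N -> 'I_((m + m).+1)}]); first exact: undup_uniq.
move=> x; rewrite mem_undup; apply/mapP/forallP; [move=> [f _ ->] j|move=> xm].
  rewrite ffunE ler_norml; have := ltn_ord (f j); move: (nat_of_ord _) => k; lia.
exists [ffun j => inord (absz (x j + m%:Z))]; first by rewrite mem_enum.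
apply/ffunP => j; rewrite !ffunE; have := xm j; rewrite ler_norml => /andP[xl xu].
have xj0 : 0 <= x j + m%:Z by lia.
by rewrite inordK; [rewrite gez0_abs// addrK|lia].
Qed.

(* Two points of [H] congruent mod 4 differ by 4 times a point of [G]; this
   replaces a comparison of volumes. *)
Lemma lattice_doubling (J : {set 'I_N}) (G H : seq V) :
  uniq H -> (forall x j, x \in H -> j \notin J -> x j = 0) ->
  (forall x y z, x \in H -> y \in H -> x - y = z *+ 4 -> z \in G) ->
  (size H <= 4 ^ #|J| * size G)%N.
Proof.
move=> uH HJ HG.
(* Residue class mod 4. Points of [H] vanish off [J], so at most [4 ^ #|J|] classes occur. *)
pose cls (x : V) : {ffun 'I_N -> 'I_4} := [ffun j => inord `|(x j %% 4)%Z|%N].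
pose A : pred {ffun 'I_N -> 'I_4} := mem (pffun_on ord0 (mem J) predT).
have cardA : #|A| = (4 ^ #|J|)%N.
  by rewrite card_pffun_on card_ord.
have clsA x : x \in H -> A (cls x).
  move=> xH; apply/pffun_onP; split => //; apply/fintype.subsetP => j.
  rewrite !inE; apply: contraNT => jJ.
  by rewrite ffunE HJ//; apply/eqP/val_inj; rewrite /= inordK.
rewrite -sum1_size big_seq (partition_big cls A)//= -cardA -sum_nat_const.
apply: leq_sum => f _; rewrite -big_seq_cond sum1_count -size_filter.
case fE : [seq x <- H | cls x == f] => [//|y s].
have yH : y \in [seq x <- H | cls x == f] by rewrite fE mem_head.
move: yH; rewrite mem_filter => /andP[/eqP yf yH].
(* With [y] a fixed representative of the class, [x |-> (x - y) / 4] is exact on the class and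
   injects it into [G]. *)
pose g (x : V) : V := [ffun j => ((x j - y j) %/ 4)%Z].
have gP x : x \in H -> cls x = f -> x - y = g x *+ 4.
  move=> xH xf; apply/ffunP => j; rewrite ffunMnE !ffunE.
  have /ffunP/(_ j) : cls x = cls y by rewrite xf yf.
  by rewrite !ffunE => /(congr1 val); rewrite /= !inordK; lia.
rewrite -fE -[leqLHS](size_map g) uniq_leq_size//.
  rewrite map_inj_in_uniq ?filter_uniq// => x z.
  rewrite !mem_filter => /andP[/eqP xf xH] /andP[/eqP zf zH] gxz.
  by apply: (addIr (- y)); rewrite gP// gxz -gP.
move=> z /mapP[x]; rewrite mem_filter => /andP[/eqP xf xH] ->.
exact: HG xH yH (gP _ xH xf).
Qed.

Lemma le_symmetric_sum_expR (R : realType) (F : V -> R) (G H : seq V) (x0 : V) :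
  uniq G -> uniq H -> {morph F : x y / x + y} ->
  (forall x, x \in G -> - x \in G) -> (forall x, x \in G -> x0 + x \in H) ->
  (size G)%:R * expR (F x0) <= \sum_(x <- H) expR (F x).
Proof.
move=> uG uH FD GN GH.
have FN x : F (- x) = - F x.
  have F0 : F 0 = 0 by apply: (addrI (F 0)); rewrite -FD !addr0.
  by apply: (addrI (F x)); rewrite -FD !subrr F0.
have -> : \sum_(x <- H) expR (F x) = \sum_(x <- H | x \in [seq x0 + y | y <- G]) expR (F x) +
    \sum_(x <- H | x \notin [seq x0 + y | y <- G]) expR (F x).
  exact: bigID.
rewrite ler_wpDr ?sumr_ge0//.
have perm_xG : perm_eq [seq x <- H | x \in [seq x0 + y | y <- G]] [seq x0 + y | y <- G].
  apply: uniq_perm; [exact: filter_uniq|by rewrite (map_inj_uniq (addrI x0))|].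
  move=> x; rewrite mem_filter; apply: andb_idr => /mapP[y yG ->]; exact: GH.
rewrite -big_filter (perm_big _ perm_xG) big_map.
under eq_bigr do rewrite FD expRD.
rewrite -mulr_sumr mulrC ler_wpM2l ?expR_ge0//.
(* By symmetry the exponential average over [x0 + G] is at least that at [x0]. *)
have sum_sym : \sum_(x <- G) expR (F x) = \sum_(x <- G) expR (- F x).
  under [RHS]eq_bigr do rewrite -FN.
  rewrite -[RHS](big_map -%R predT (fun x => expR (F x))); apply: perm_big.
  apply: uniq_perm; [by []|by rewrite (map_inj_uniq oppr_inj)|].
  move=> x; apply/idP/mapP => [xG|[y yG ->]]; last exact: GN.
  by exists (- x); rewrite ?opprK// GN.
(* Pairing [x] with [- x] uses only [exp t + exp (- t) >= 2], a consequence of [exp t >= 1 + t]. *)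
suff : 2 * (size G)%:R <= \sum_(x <- G) expR (F x) + \sum_(x <- G) expR (- F x).
  by rewrite -sum_sym; lra.
rewrite -big_split/= -sum1_size natr_sum mulr_sumr; apply: ler_sum => x _.
by have := expR_ge1Dx (F x); have := expR_ge1Dx (- F x); lra.
Qed.

End LatticePoints.

(** * Deviations of the empirical process *)

(** Rounding toward zero, rather than to the nearest integer, keeps a rounded vector within the same
    l1 ball and the same support. *)
Lemma round_toward_zero (R : realType) (x : R) :
  exists z : int, [/\ `|z|%:~R <= `|x|, `|x - z%:~R| <= 1 & x = 0 -> z = 0].
Proof.
wlog x0 : x / 0 <= x => [wlog_x|].
  have [/wlog_x//|/ltW x0] := leP 0 x.
  have [|z [zx xz z0]] := wlog_x (- x); first by rewrite oppr_ge0.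
  exists (- z); split.
  - by rewrite normrN -(normrN x).
  - by rewrite -normrN opprD intrN opprK addrC opprK addrC in xz *.
  - by move=> x_eq0; rewrite z0 ?oppr0// x_eq0 oppr0.
have /andP[zx xz] := truncn_itv x0.
exists (Num.truncn x)%:Z; split.
- by rewrite ger0_norm// -pmulrn ger0_norm.
- by rewrite -pmulrn ger0_norm ?subr_ge0// lerBlDr addrC natr1 ltW.
- by move=> ->; rewrite truncn0.
Qed.

Section Deviations.
Context (R : realType) dO dS (Omega : measurableType dO) (S : measurableType dS).
Context (Pr : probability Omega R) (P : probability S R) (n N : nat).
Variables (X : 'I_n -> {mfun Omega >-> S}) (h : 'I_N -> S -> R).
Hypothesis iidX : iid_sample Pr P X.
Hypotheses (mh : forall j, measurable_fun setT (h j)) (h0 : forall j x, 0 <= h j x).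
Hypotheses (h1 : forall j x, h j x <= 1) (n_gt0 : (0 < n)%N).
Implicit Types (v u : 'I_N -> R) (w : Omega) (l : R).

Let bh j : bounded_measurable (h j).
Proof. by split => //; exists 1 => x; rewrite ger0_norm. Qed.

Lemma bounded_measurable_mixture v : bounded_measurable (mixture h v).
Proof. by apply: bounded_measurable_sum => j; exact: bounded_measurableZ. Qed.

Lemma normr_mixture_le v x : `|mixture h v x| <= \sum_j `|v j|.
Proof.
rewrite (le_trans (ler_norm_sum _ _ _))// ler_sum// => j _.
by rewrite normrM (ger0_norm (h0 j x)) ler_piMr.
Qed.

Definition deviation w (j : 'I_N) : R := empirical_mean X w (h j) - mean P (h j).

Lemma mean_mixture v : mean P (mixture h v) = \sum_j v j * mean P (h j).
Proof.
rewrite mean_sum => [|j]; last exact: bounded_measurableZ.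
by apply: eq_bigr => j _; rewrite meanZ.
Qed.

Lemma empirical_mean_mixture w v :
  empirical_mean X w (mixture h v) = \sum_j v j * empirical_mean X w (h j).
Proof.
rewrite /empirical_mean /mixture exchange_big mulr_sumr; apply: eq_bigr => j _ /=.
by rewrite -mulr_sumr mulrCA.
Qed.

Lemma deviation_mixture w v :
  \sum_j v j * deviation w j = empirical_mean X w (mixture h v) - mean P (mixture h v).
Proof.
rewrite mean_mixture empirical_mean_mixture -sumrB.
by apply: eq_bigr => j _; rewrite mulrBr.
Qed.

(** Both means of [h j] lie in [[0, 1]]. This crude bound controls rounding errors and settles the
    case [r >= 1]. *)
Lemma normr_deviation_le1 w j : `|deviation w j| <= 1.
Proof.
have : 0 <= empirical_mean X w (h j) <= 1.
  rewrite /empirical_mean mulr_ge0 ?invr_ge0 ?sumr_ge0//=.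
  rewrite ler_pdivrMl ?ltr0n// mulr1.
  have <- : \sum_(i < n) 1 = n%:R :> R by rewrite sumr_const card_ord.
  exact: ler_sum.
have : 0 <= mean P (h j) <= 1.
  rewrite -{1}(mean_cst P 0) -(mean_cst P 1).
  by rewrite !mean_le//; exact: bounded_measurable_cst.
by rewrite /deviation ler_norml => /andP[? ?] /andP[? ?]; lra.
Qed.

Lemma measurable_deviation j : measurable_fun setT (deviation ^~ j).
Proof.
apply: measurable_funB => //; apply: measurable_funM => //.
apply: measurable_sum => i; apply: measurableT_comp (mh j) _.
exact: measurable_funPT.
Qed.

Definition second_moment v : R := mean P (fun x => mixture h v x ^+ 2).

Let bmX v k : bounded_measurable (fun x => mixture h v x ^+ k).
Proof. exact/bounded_measurableX/bounded_measurable_mixture. Qed.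

Lemma mixtureD v u x :
  mixture h (fun j => v j + u j) x = mixture h v x + mixture h u x.
Proof. by rewrite /mixture -big_split; apply: eq_bigr => j _; rewrite mulrDl. Qed.

Lemma mixtureZ (a : R) v x : mixture h (fun j => a * v j) x = a * mixture h v x.
Proof. by rewrite /mixture mulr_sumr; apply: eq_bigr => j _; rewrite mulrA. Qed.

(** Plays the role of the triangle inequality: two vectors with second moment at most [D] have a sum
    with second moment at most [4 D], so [G + G] lies in [2 G]. *)
Lemma second_momentD_le v u :
  second_moment (fun j => v j + u j) <= 2 * second_moment v + 2 * second_moment u.
Proof.
rewrite -!(meanZ P _ (bmX _ _)) -(meanD P); last 2 first.
- exact/bounded_measurableZ/bmX.
- exact/bounded_measurableZ/bmX.
apply: mean_le; [exact: bmX| |].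
  by apply: bounded_measurableD; exact/bounded_measurableZ/bmX.
by move=> x; rewrite mixtureD; have := sqr_ge0 (mixture h v x - mixture h u x); nra.
Qed.

Lemma second_momentZ (a : R) v :
  second_moment (fun j => a * v j) = a ^+ 2 * second_moment v.
Proof.
by rewrite -(meanZ P _ (bmX _ _)); congr mean; apply/funext => x; rewrite mixtureZ exprMn.
Qed.

Lemma second_moment_le v (c : R) : \sum_j `|v j| <= c -> second_moment v <= c ^+ 2.
Proof.
move=> vc; rewrite -(mean_cst P (c ^+ 2)); apply: mean_le.
- exact: bmX.
- exact: bounded_measurable_cst.
move=> x; rewrite -(real_normK (num_real (mixture h v x))).
have := normr_mixture_le v x; have := normr_ge0 (mixture h v x); nra.
Qed.

(** [n (P_n - P) f_v] is a sum of [n] independent centred terms, so the exponential moment is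
    bounded by a product of [n] one-observation moments. *)
Lemma exp_moment_deviation_le v l (Q : R) :
  \sum_j `|v j| <= 4 -> 0 <= l -> l <= 1 / 16 -> second_moment v <= Q ->
  (\int[Pr]_w (expR (l * n%:R * \sum_j v j * deviation w j))%:E <=
   (expR (n%:R * (2 * l ^+ 2 * Q)))%:E)%E.
Proof.
move=> v4 l0 l16 vQ; set f := mixture h v.
have f4 x : `|f x| <= 4 by exact: le_trans (normr_mixture_le v x) v4.
have [mf _] := bounded_measurable_mixture v.
have prodE w : expR (l * n%:R * \sum_j v j * deviation w j) =
    \prod_(i < n) expR (l * (f (X i w) - mean P f)).
  rewrite -expR_sum deviation_mixture -/f; congr expR.
  rewrite -mulr_sumr sumrB sumr_const card_ord /empirical_mean -mulr_natl.
  by field; rewrite pnatr_eq0 -lt0n.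
under eq_integral do rewrite prodE.
have -> : expR (n%:R * (2 * l ^+ 2 * Q)) = \prod_(i < n) expR (2 * l ^+ 2 * Q).
  by rewrite -expR_sum sumr_const card_ord mulr_natl.
apply: (iid_expectation_prod_le iidX (phi := fun _ x => expR (l * (f x - mean P f)))).
- move=> _; apply: measurableT_comp => //.
  by apply: measurable_funM => //; exact: measurable_funB.
- by move=> _ x; exact: expR_ge0.
- by move=> _; exact: expR_ge0.
- by move=> _; exact: exp_moment_le.
Qed.

Implicit Types z : {ffun 'I_N -> int}.

(** Integer points are rescaled to the lattice of mesh [1 / q], so that counting and congruences
    stay in the integers. *)
Definition lattice_vector (q : nat) z : 'I_N -> R :=
  fun j => q%:R^-1 * (z j)%:~R.

Let lattice_vectorD q z z' :
  lattice_vector q (z + z') = (fun j => lattice_vector q z j + lattice_vector q z' j).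
Proof. by apply/funext => j; rewrite /lattice_vector ffunE intrD mulrDr. Qed.

Let lattice_vectorN q z : lattice_vector q (- z) = (fun j => -1 * lattice_vector q z j).
Proof. by apply/funext => j; rewrite /lattice_vector ffunE intrN mulrN mulN1r. Qed.

(* [Y] is the normalized average of [exp F] over the lattice points of the body
   [2 G], which dominates [exp F] at every lattice point of [G]. *)
Lemma lattice_level_exp_moment (J : {set 'I_N}) (q : nat) (l delta2 : R) :
  (0 < q)%N -> 0 <= l -> l <= 1 / 16 -> 0 <= delta2 ->
  exists Y : Omega -> R, [/\ measurable_fun setT Y, forall w, 0 <= Y w,
    (\int[Pr]_w (Y w)%:E <= 1)%E &
    forall w (z : {ffun 'I_N -> int}), (forall j, j \notin J -> z j = 0) ->
      \sum_j `|z j| <= (2 * q)%:Z -> second_moment (lattice_vector q z) <= delta2 ->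
      expR (l * n%:R * \sum_j lattice_vector q z j * deviation w j) <=
      4 ^+ #|J| * expR (n%:R * (2 * l ^+ 2 * (4 * delta2))) * Y w].
Proof.
move=> q0 l0 l16 delta0.
have qR0 : 0 < q%:R :> R by rewrite ltr0n.
pose body (m : nat) (D : R) : pred {ffun 'I_N -> int} := fun z =>
  [&& [forall j, (j \notin J) ==> (z j == 0)], \sum_j `|z j| <= m%:Z
    & second_moment (lattice_vector q z) <= D].
have bodyP m D z : reflect [/\ forall j, j \notin J -> z j = 0, \sum_j `|z j| <= m%:Z
    & second_moment (lattice_vector q z) <= D] (body m D z).
  apply: (iffP and3P) => -[zJ zm zD]; split => //.
    by move=> j jJ; apply/eqP; exact: (implyP (forallP zJ j)).
  by apply/forallP => j; apply/implyP => /zJ ->.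
have [s us sP] := lattice_box N (4 * q).
(* [H] enumerates [2 G]: in units of [1 / q] the l1 radius goes from 2 to 4, and the second moment,
   being quadratic, is multiplied by 4. *)
pose H := [seq z <- s | body (4 * q)%N (4 * delta2) z].
pose G := [seq z <- s | body (2 * q)%N delta2 z].
have norm1_le m (z : {ffun 'I_N -> int}) : \sum_j `|z j| <= m%:Z -> forall j, `|z j| <= m%:Z.
  by move=> zm j; rewrite (le_trans _ zm)// (bigD1 j)//= lerDl sumr_ge0.
have inH z : (z \in H) = body (4 * q)%N (4 * delta2) z.
  rewrite mem_filter; apply: andb_idr => /bodyP[_ zm _].
  by rewrite sP; apply/forallP; exact: norm1_le.
have inG z : (z \in G) = body (2 * q)%N delta2 z.
  rewrite mem_filter; apply: andb_idr => /bodyP[_ zm _].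
  rewrite sP; apply/forallP => j; rewrite (le_trans (norm1_le _ _ zm j))//.
  by rewrite lez_nat leq_mul2r orbT.
have uH : uniq H by exact: filter_uniq.
have uG : uniq G by exact: filter_uniq.
have norm1D (z z' : {ffun 'I_N -> int}) :
    \sum_j `|(z + z') j| <= \sum_j `|z j| + \sum_j `|z' j|.
  by rewrite -big_split ler_sum// => j _; rewrite ffunE ler_normD.
have norm1N (z : {ffun 'I_N -> int}) : \sum_j `|(- z) j| = \sum_j `|z j|.
  by apply: eq_bigr => j _; rewrite ffunE normrN.
have momentN z : second_moment (lattice_vector q (- z)) = second_moment (lattice_vector q z).
  by rewrite lattice_vectorN second_momentZ sqrrN expr1n mul1r.
have G0 : 0 \in G.
  rewrite inG; apply/bodyP; split => [j _||]; first by rewrite ffunE.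
    by rewrite big1// => j _; rewrite ffunE normr0.
  apply: (@le_trans _ _ (0 ^+ 2)); last by rewrite expr0n.
  by apply: second_moment_le; rewrite big1// => j _; rewrite /lattice_vector ffunE mulr0 normr0.
(* If [x - y = 4 z] with [x], [y] in [2 G], then [4 |z|_1 <= 8 q], and 16 times the second moment of
   [z] is at most [2 (4 delta2) + 2 (4 delta2)]; hence [z] lies in [G]. *)
have sizeHG : (size H <= 4 ^ #|J| * size G)%N.
  apply: lattice_doubling => // [x j|x y z].
    by rewrite inH => /bodyP[xJ _ _] /xJ.
  rewrite !inH inG => /bodyP[xJ xm xD] /bodyP[yJ ym yD] xyz.
  have zE j : x j - y j = z j *+ 4 by move/ffunP/(_ j): xyz; rewrite ffunMnE !ffunE.
  apply/bodyP; split => [j jJ||].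
  - by have := zE j; rewrite xJ// yJ// subr0 => /eqP; rewrite eq_sym mulrn_eq0 => /orP[//|/eqP].
  - have : \sum_j `|z j| *+ 4 <= (4 * q)%:Z + (4 * q)%:Z.
      rewrite (le_trans _ (lerD xm ym))// -(norm1N y) (le_trans _ (norm1D _ _))//.
      by rewrite ler_sum// => j _; rewrite xyz ffunMnE normrMn.
    by rewrite sumrMnl; move: (\sum_j _) => a; clear; lia.
  - have := second_momentD_le (lattice_vector q x) (lattice_vector q (- y)).
    rewrite -lattice_vectorD xyz momentN.
    have -> : lattice_vector q (z *+ 4) = (fun j => 4 * lattice_vector q z j).
      by apply/funext => j; rewrite /lattice_vector ffunMnE rmorphMn -mulr_natl; ring.
    by rewrite second_momentZ; lra.
have size0 : 0 < (size G)%:R :> R by rewrite ltr0n; case: (G) G0.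
have GH : {subset G <= H}.
  move=> z; rewrite inG inH => /bodyP[zJ zm zD]; apply/bodyP; split => //.
    by rewrite (le_trans zm)// lez_nat leq_mul2r orbT.
  by rewrite (le_trans zD)//; lra.
have sizeH0 : 0 < (size H)%:R :> R by rewrite ltr0n; case: (H) (GH _ G0).
pose F w (z : {ffun 'I_N -> int}) := l * n%:R * \sum_j lattice_vector q z j * deviation w j.
have FD w : {morph F w : x y / x + y}.
  move=> x y; rewrite /F lattice_vectorD -mulrDr -big_split; congr (_ * _).
  by apply: eq_bigr => j _; rewrite mulrDl.
pose K := expR (n%:R * (2 * l ^+ 2 * (4 * delta2))).
have K0 : 0 < K by exact: expR_gt0.
pose Y w := ((size H)%:R * K)^-1 * \sum_(z <- H) expR (F w z).
have mF z : measurable_fun setT (fun w => expR (F w z)).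
  apply: measurableT_comp => //; apply: measurable_funM => //.
  by apply: measurable_sum => j; apply: measurable_funM => //; exact: measurable_deviation.
have c0 : 0 <= ((size H)%:R * K)^-1 by rewrite invr_ge0 mulr_ge0// ltW.
have Y0 w : 0 <= Y w.
  by apply: mulr_ge0 => //; apply: sumr_ge0 => z _; exact: expR_ge0.
exists Y; split => //.
- by apply: measurable_funM => //; exact: measurable_sum.
- under eq_integral do rewrite EFinM.
  rewrite ge0_integralZl_EFin//; last 2 first.
  + by move=> w _; rewrite lee_fin sumr_ge0// => z _; exact: expR_ge0.
  + by apply/measurable_EFinP; exact: measurable_sum.
  rewrite lee_pdivrMl ?mulr_gt0// mule1.
  under eq_integral do rewrite -sumEFin.
  rewrite ge0_integral_sum//; last by move=> z; exact/measurable_EFinP.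
  apply: (@le_trans _ _ (\sum_(z <- H) K%:E)%E); last first.
    rewrite sumEFin lee_fin -sum1_size natr_sum mulr_suml.
    by apply: ler_sum => z _; rewrite mul1r.
  rewrite big_seq [leRHS]big_seq; apply: lee_sum => z; rewrite inH => /bodyP[zJ zm zD].
  apply: exp_moment_deviation_le => //.
  rewrite /lattice_vector; under eq_bigr do rewrite normrM gtr0_norm ?invr_gt0//.
  rewrite -mulr_sumr ler_pdivrMl//.
  have -> : \sum_j `|(z j)%:~R| = (\sum_j `|z j|)%:~R :> R.
    by rewrite rmorph_sum; apply: eq_bigr => j _; rewrite /= intr_norm.
  by move: zm; rewrite -(ler_int R) => /le_trans; apply; rewrite -pmulrn natrM mulrC.
- move=> w z zJ zm zD.
  have zG : z \in G by rewrite inG; apply/bodyP.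
  have := le_symmetric_sum_expR (x0 := z) uG uH (FD w); rewrite -/(F w z) => leF.
  have {}leF : (size G)%:R * expR (F w z) <= (size H)%:R * K * Y w.
    rewrite /Y mulVKf ?gt_eqF ?mulr_gt0//; apply: leF => x.
      rewrite !inG => /bodyP[xJ xm xD]; apply/bodyP; split.
      - by move=> j jJ; rewrite ffunE xJ// oppr0.
      - by rewrite norm1N.
      - by rewrite momentN.
    rewrite inG inH => /bodyP[xJ xm xD]; apply/bodyP; split.
    - by move=> j jJ; rewrite ffunE zJ// xJ// addr0.
    - by rewrite (le_trans (norm1D _ _))// (le_trans (lerD zm xm))// -PoszD lez_nat -mulnDl.
    - by rewrite lattice_vectorD (le_trans (second_momentD_le _ _))//; lra.
  (* The average over [z + G] has been bounded through the sum over [H]; the ratio of the two sizes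
     costs the factor [4 ^+ #|J|]. *)
  rewrite -/K -(ler_pM2l size0) (le_trans leF)//.
  have -> : (size G)%:R * (4 ^+ #|J| * K * Y w) = 4 ^+ #|J| * (size G)%:R * K * Y w by ring.
  have sizeR : (size H)%:R <= 4 ^+ #|J| * (size G)%:R :> R.
    by move: sizeHG; rewrite -(ler_nat R) natrM natrX.
  by rewrite ler_wpM2r// ler_wpM2r// ltW.
Qed.

(** One application of Markov's inequality to [2 N + L + 1] normalized exponentials: two signs for
    each coordinate and one average for each level [s^2 = 4^k r]. *)
Lemma uniform_deviation_event (J : {set 'I_N}) (q L : nat) (r kappa T : R) :
  (0 < q)%N -> 0 < r -> r < 1 -> 1 <= kappa -> 0 < T ->
  #|J|%:R <= n%:R * r -> ln (T * (2 * N + L.+1)%:R) <= kappa * (n%:R * r) ->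
  holds_with_prob_ge Pr (1 - T^-1) (fun w =>
    (forall j, `|deviation w j| <= 17 * kappa * Num.sqrt r) /\
    forall k, (k <= L)%N -> forall z, (forall j, j \notin J -> z j = 0) ->
      \sum_j `|z j| <= (2 * q)%:Z -> second_moment (lattice_vector q z) <= 4 ^+ k * r ->
      \sum_j lattice_vector q z j * deviation w j <= 64 * kappa * (2 ^+ k * r)).
Proof.
move=> q0 r0 r1 kappa1 T0 Jr lnT.
have nR0 : 0 < n%:R :> R by rewrite ltr0n.
set t := ln _ in lnT.
have sr0 : 0 < Num.sqrt r by rewrite sqrtr_gt0.
have sr1 : Num.sqrt r <= 1 by rewrite -sqrtr1 ler_wsqrtr// ltW.
have srE : Num.sqrt r ^+ 2 = r by rewrite sqr_sqrtr// ltW.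
(* The exponents [lh] and [lk k] balance the variance and deviation terms of
   the exponential moments. *)
pose lh : R := Num.sqrt r / 16.
pose lk (k : nat) : R := 2 ^- k / 16.
have lk_itv k : 0 < lk k <= 1 / 16.
  rewrite divr_gt0 ?invr_gt0 ?exprn_gt0//= ler_pM2r ?invr_gt0//.
  by rewrite invf_le1 ?exprn_gt0// exprn_ege1// ler1n.
have level (k : 'I_L.+1) := @lattice_level_exp_moment J q (lk k) (4 ^+ k * r) q0
  (ltW (proj1 (andP (lk_itv k)))) (proj2 (andP (lk_itv k)))
  (mulr_ge0 (exprn_ge0 k (ler0n R 4)) (ltW r0)).
pose Yk k := sval (cid (level k)).
have YkP k := svalP (cid (level k)).
pose sgn (b : bool) : R := (-1) ^+ b.
pose e (b : bool) (j i : 'I_N) : R := sgn b * (i == j)%:R.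
have eE w b j : \sum_i e b j i * deviation w i = sgn b * deviation w j.
  rewrite (bigD1 j)//= big1 ?addr0 => [|i /negbTE ij]; last by rewrite /e ij mulr0 mul0r.
  by rewrite /e eqxx mulr1.
have e1 b j : \sum_i `|e b j i| <= 1.
  rewrite (bigD1 j)//= big1 ?addr0 => [|i /negbTE ij]; last by rewrite /e ij mulr0 normr0.
  by rewrite /e eqxx mulr1 normrX normrN1 expr1n.
pose Kh := expR (n%:R * (2 * lh ^+ 2 * 1)).
pose Yh b j w := Kh^-1 * expR (lh * n%:R * (sgn b * deviation w j)).
pose Y (i : (bool * 'I_N) + 'I_L.+1) : Omega -> R :=
  match i with inl (b, j) => Yh b j | inr k => Yk k end.
have Kh0 : 0 < Kh by exact: expR_gt0.
have mYh b j : measurable_fun setT (fun w => expR (lh * n%:R * (sgn b * deviation w j))).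
  apply: measurableT_comp => //; apply: measurable_funM => //.
  by apply: measurable_funM => //; exact: measurable_deviation.
have card_idx : #|{: (bool * 'I_N) + 'I_L.+1}| = (2 * N + L.+1)%N.
  by rewrite card_sum card_prod card_bool !card_ord.
have [] := @finite_family_markov R _ _ Pr _ Y T; rewrite ?card_idx//.
- by rewrite addnS.
- by case=> [[b j]|k] /=; [exact: measurable_funM|case: (YkP k)].
- case=> [[b j]|k] w; last by case: (YkP k) => _ Yk0 _ _; exact: Yk0.
  apply: mulr_ge0; first by rewrite invr_ge0 expR_ge0.
  exact: expR_ge0.
- case=> [[b j]|k] /=; last by case: (YkP k).
  rewrite /Yh; under eq_integral do rewrite EFinM.
  rewrite ge0_integralZl_EFin//; last 2 first.
  + exact/measurable_EFinP.
  + by rewrite invr_ge0 ltW.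
  rewrite lee_pdivrMl// mule1; under eq_integral do rewrite -eE.
  apply: (exp_moment_deviation_le (v := e b j)).
  + by rewrite (le_trans (e1 b j))// ler1n.
  + by rewrite divr_ge0 ?ltW.
  + by rewrite ler_pM2r ?invr_gt0.
  + by rewrite (le_trans (second_moment_le (e1 b j)))// expr1n.
move=> E [mE PE EY]; exists E; split => // w /EY {}EY.
have expT : expR t = T * (2 * N + L.+1)%:R.
  by rewrite lnK// posrE mulr_gt0// ltr0n addnS.
split=> [j|k kL z zJ zq zD].
(* The exponents give [sqrt r n D <= 16 t + n r / 8] for the signed deviation [D], and
   [t <= kappa n r]; this is where 17 comes from. *)
- have dev_le b : sgn b * deviation w j <= 17 * kappa * Num.sqrt r.
    have := EY (inl (b, j)); rewrite /= /Yh -expT ler_pdivrMl// -expRD ler_expR => le1.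
    have : Num.sqrt r * n%:R * (sgn b * deviation w j) <= Num.sqrt r * n%:R * (17 * kappa * Num.sqrt r).
      have -> : Num.sqrt r * n%:R * (17 * kappa * Num.sqrt r) = 17 * (kappa * (n%:R * r)).
        by transitivity (17 * (kappa * (n%:R * Num.sqrt r ^+ 2))); [ring|rewrite srE].
      move: le1; rewrite /lh expr_div_n srE; set D := sgn b * _ => le1.
      have nr0 : 0 <= n%:R * r by rewrite mulr_ge0 ?ltW.
      have knr : n%:R * r <= kappa * (n%:R * r) by rewrite ler_peMl.
      by lra.
    by rewrite ler_pM2l ?mulr_gt0.
  have := dev_le false; have := dev_le true; rewrite /sgn expr0 expr1 mul1r mulN1r.
  by rewrite ler_norml; lra.
have k_ord : (k < L.+1)%N by [].
have [_ _ _ /(_ w z zJ zq zD)] := YkP (Ordinal k_ord).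
have := EY (inr (Ordinal k_ord)); rewrite /= -/(Yk _) -expT; set Yw := Yk _ w => YwT leY.
have expk0 : 0 < 4 ^+ #|J| * expR (n%:R * (2 * lk k ^+ 2 * (4 * (4 ^+ k * r)))).
  by rewrite mulr_gt0 ?exprn_gt0// expR_gt0.
(* With the chosen [lk k] the variance term is the same at every level. *)
have lkE : 2 * lk k ^+ 2 * (4 * (4 ^+ k * r)) = r / 32.
  rewrite /lk expr_div_n exprVn -exprM mulnC exprM.
  have -> : 2 ^+ 2 = 4 :> R by rewrite -natrX.
  by field; rewrite expf_neq0// pnatr_eq0.
have := le_trans leY (ler_wpM2l (ltW expk0) YwT).
have ln4 : ln 4 <= 2 :> R.
  have -> : 4 = 2 ^+ 2 :> R by rewrite -natrX.
  rewrite lnXn// mulr2n; have := @le_ln1Dx R 1.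
  by rewrite (_ : 1 + 1 = 2)//; lra.
have -> : 4 ^+ #|J| = expR (#|J|%:R * ln 4) :> R by rewrite expRM_natl lnK// posrE.
rewrite lkE -!expRD ler_expR; set D := \sum_j _ => leD.
have lk0 : 0 < lk k * n%:R by rewrite mulr_gt0//; case/andP: (lk_itv k).
(* The exponent is at most [#|J| ln 4 + n r / 32 + t], hence at most [(2 + 1 / 32 + 1) kappa n r];
   dividing the larger value [4 kappa n r] by [n / (16 2^k)] gives the constant 64. *)
rewrite -(ler_pM2l lk0).
have -> : lk k * n%:R * (64 * kappa * (2 ^+ k * r)) = 4 * (kappa * (n%:R * r)).
  by rewrite /lk; field; rewrite expf_neq0// pnatr_eq0.
have nr0 : 0 <= n%:R * r by rewrite mulr_ge0 ?ltW.
have knr : n%:R * r <= kappa * (n%:R * r) by rewrite ler_peMl.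
have Jln : #|J|%:R * ln 4 <= n%:R * r * 2.
  by rewrite ler_pM// ln_ge0// ler1n.
by rewrite (le_trans leD)//; lra.
Qed.

(** For a fixed [w]: [v] is rounded to the lattice with an l1 error at most [N / q <= r], and the
    bound of the smallest level containing the rounded vector is used. *)
Lemma deviation_le_of_lattice (J : {set 'I_N}) (q L : nat) (r kappa : R) w :
  0 < r -> r < 1 -> 1 <= kappa -> N%:R <= q%:R * r -> (0 < q)%N -> 20 <= 4 ^+ L * r ->
  (forall k, (k <= L)%N -> forall z, (forall j, j \notin J -> z j = 0) ->
      \sum_j `|z j| <= (2 * q)%:Z -> second_moment (lattice_vector q z) <= 4 ^+ k * r ->
      \sum_j lattice_vector q z j * deviation w j <= 64 * kappa * (2 ^+ k * r)) ->
  forall (v : 'I_N -> R) (s : R), (forall j, j \notin J -> v j = 0) ->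
    \sum_j `|v j| <= 2 -> 0 <= s -> second_moment v <= s ^+ 2 ->
    \sum_j v j * deviation w j <= 200 * kappa * (Num.sqrt r * s + r).
Proof.
move=> r0 r1 kappa1 Nqr q0 Lr dev_lattice v s vJ v2 s0 vs.
have sr0 : 0 < Num.sqrt r by rewrite sqrtr_gt0.
have srE : Num.sqrt r ^+ 2 = r by rewrite sqr_sqrtr// ltW.
(* Since [|v|_1 <= 2], the second moment is at most 4 and [s] may be capped at 2; then level [L] is
   large enough, as [2 s^2 + 2 r <= 10]. *)
wlog s2 : s s0 vs / s <= 2 => [wlog_s|].
  have [/(wlog_s s s0 vs)//|s2] := leP s 2.
  apply: (le_trans (wlog_s 2 (ler0n _ _) (second_moment_le v2) (lexx _))).
  rewrite ler_wpM2l ?mulr_ge0// ?(le_trans ler01)//.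
  by rewrite lerD2r ler_wpM2l ?(ltW sr0)// ltW.
have qR0 : 0 < q%:R :> R by rewrite ltr0n.
pose z : {ffun 'I_N -> int} := [ffun j => sval (cid (round_toward_zero (q%:R * v j)))].
have zP j : [/\ `|z j|%:~R <= q%:R * `|v j|, `|q%:R * v j - (z j)%:~R| <= 1
    & v j = 0 -> z j = 0].
  rewrite ffunE; case: (svalP (cid (round_toward_zero (q%:R * v j)))) => zv vz v0.
  split=> [||vj0]; [|by []|by rewrite v0 ?vj0 ?mulr0].
  by rewrite (le_trans zv)// normrM gtr0_norm.
pose u j := v j - lattice_vector q z j.
have uN j : `|u j| <= q%:R^-1.
  have [_ le1 _] := zP j.
  have -> : u j = q%:R^-1 * (q%:R * v j - (z j)%:~R).
    by rewrite mulrBr mulKf ?gt_eqF.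
  by rewrite normrM gtr0_norm ?invr_gt0// -[leRHS]mulr1 ler_pM2l ?invr_gt0.
have u1 : \sum_j `|u j| <= r.
  apply: (@le_trans _ _ (\sum_(j < N) q%:R^-1)); first exact: ler_sum.
  by rewrite sumr_const card_ord -[leLHS]mulr_natl ler_pdivrMr// mulrC.
have uD : \sum_j u j * deviation w j <= r.
  apply: le_trans u1; apply: ler_sum => j _; apply: (le_trans (ler_norm _)).
  by rewrite normrM ler_piMr// normr_deviation_le1.
have zu j : lattice_vector q z j = v j + - u j by rewrite /u opprB addrC subrK.
have z_moment : second_moment (lattice_vector q z) <= 2 * s ^+ 2 + 2 * r.
  have -> : lattice_vector q z = (fun j => v j + - u j) by apply/funext.
  rewrite (le_trans (second_momentD_le _ _))// lerD ?ler_pM2l//.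
  apply: (@le_trans _ _ (r ^+ 2)); last by rewrite expr2 ler_piMl ?ltW.
  apply: second_moment_le => //.
  by under eq_bigr do rewrite normrN.
have z1 : \sum_j `|z j| <= (2 * q)%:Z.
  rewrite -(ler_int R) rmorph_sum/= -pmulrn natrM mulrC.
  apply: (@le_trans _ _ (\sum_j q%:R * `|v j|)); last by rewrite -mulr_sumr ler_pM2l.
  by apply: ler_sum => j _; case: (zP j).
have zJ j : j \notin J -> z j = 0 by move=> /vJ; case: (zP j).
pose ok k := 2 * s ^+ 2 + 2 * r <= 4 ^+ k * r.
have okL : ok L.
  apply: le_trans Lr; have : s ^+ 2 <= 2 ^+ 2 by rewrite lerXn2r// nnegrE.
  by lra.
have [k kok kmin] := ex_minnP (ex_intro ok L okL).
have := dev_lattice k (kmin L okL) z zJ z1 (le_trans z_moment kok).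
(* For [k > 0] minimality says that level [k - 1] fails, so [(2^k r)^2 <= 4 r (2 s^2 + 2 r)]. At the
   end [64 * 3 = 192] leaves room within 200 for the rounding error. *)
have kr : 2 ^+ k * r <= 3 * (Num.sqrt r * s + r).
  have srs : 0 <= Num.sqrt r * s by rewrite mulr_ge0// ltW.
  case: k kok kmin => [|k] kok kmin; first by rewrite expr0 mul1r; lra.
  have : ~~ ok k by apply/negP => /kmin; rewrite ltnn.
  rewrite /ok -ltNge => lt_k.
  have sqr_le : (2 ^+ k.+1 * r) ^+ 2 <= (3 * (Num.sqrt r * s + r)) ^+ 2.
    apply: (@le_trans _ _ (4 * r * (2 * s ^+ 2 + 2 * r))).
      have -> : (2 ^+ k.+1 * r) ^+ 2 = 4 * r * (4 ^+ k * r).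
        rewrite exprMn -exprM mulnC exprM (_ : 2 ^+ 2 = 4); last by rewrite -natrX.
        by rewrite exprS; ring.
      by rewrite ler_wpM2l ?mulr_ge0// ?ltW.
    have -> : (3 * (Num.sqrt r * s + r)) ^+ 2 =
        9 * (Num.sqrt r ^+ 2 * s ^+ 2 + r ^+ 2) + 18 * (Num.sqrt r * s * r) by ring.
    rewrite srE; have : 0 <= r * s ^+ 2 by rewrite mulr_ge0 ?sqr_ge0 ?ltW.
    have : 0 <= Num.sqrt r * s * r by rewrite mulr_ge0// ltW.
    by have := sqr_ge0 r; nra.
  have rhs0 : 0 <= 3 * (Num.sqrt r * s + r) by lra.
  by move: sqr_le; rewrite ler_sqr// nnegrE// mulr_ge0// ltW.
move=> z_dev.
have -> : \sum_j v j * deviation w j =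
    \sum_j lattice_vector q z j * deviation w j + \sum_j u j * deviation w j.
  by rewrite -big_split; apply: eq_bigr => j _ /=; rewrite zu; ring.
have srs : 0 <= Num.sqrt r * s by rewrite mulr_ge0// ltW.
set a := Num.sqrt r * s in kr srs *.
have : kappa * (2 ^+ k * r) <= kappa * (3 * (a + r)) by rewrite ler_wpM2l// (le_trans ler01).
have : a + r <= kappa * (a + r) by rewrite ler_peMl// addr_ge0// ltW.
by lra.
Qed.

End Deviations.

(** * Stability of entropy-penalized minimizers *)

Lemma ge0_of_quadratic_ge0 (R : realType) (x y : R) :
  (forall s, 0 < s < 1 -> 0 <= s * x + s ^+ 2 * y) -> 0 <= x.
Proof.
move=> xy; rewrite leNgt; apply/negP => x0.
(* Small enough that [s |y| <= - x / 2], so that [x + s y] would be negative. *)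
pose s := - x / (2 * (`|y| + 1 - x)).
have y0 := normr_ge0 y.
have d0 : 0 < 2 * (`|y| + 1 - x) by lra.
have s0 : 0 < s by rewrite divr_gt0//; lra.
have s1 : s < 1 by rewrite ltr_pdivrMr//; lra.
have sE : s * (2 * (`|y| + 1 - x)) = - x by rewrite divfK ?gt_eqF.
have := xy s; rewrite s0 s1 => /(_ isT).
have -> : s * x + s ^+ 2 * y = s * (x + s * y) by ring.
rewrite pmulr_rge0// => xsy.
have : s * y <= s * `|y| by rewrite ler_wpM2l ?ler_norm// ltW.
have : 0 <= s * (1 - x) by rewrite mulr_ge0 ?(ltW s0)//; lra.
by lra.
Qed.

(** A second-order expansion of [t ln t] obtained from [ln (y / x) <= y / x - 1], valid down to
    [y = 0]. On the simplex the terms [y - x] sum to zero. *)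
Lemma entropy_tangent_le (R : realType) (x y : R) : 0 < x -> 0 <= y ->
  y * ln y - x * ln x <= (y - x) * ln x + (y - x) + (y - x) ^+ 2 / x.
Proof.
move=> x0; rewrite le_eqVlt => /predU1P[<-|y0].
  rewrite mul0r !sub0r sqrrN expr2 mulfK ?gt_eqF//; lra.
have : ln (y / x) <= y / x - 1.
  have := @le_ln1Dx R (y / x - 1); rewrite (addrC 1) subrK; apply.
  by rewrite ltrBrDl subrr divr_gt0.
rewrite ln_div ?posrE// => /(ler_wpM2l (ltW y0)).
have -> : y * (y / x - 1) = (y - x) + (y - x) ^+ 2 / x by field; rewrite gt_eqF.
by lra.
Qed.

Section EntropicQuadratic.
Context (R : realType) (N : nat) (G : 'I_N -> 'I_N -> R).
Implicit Types (a b c u v : 'I_N -> R).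

Definition gram_form u v : R := \sum_j \sum_k u j * v k * G j k.

Hypothesis GC : forall j k, G j k = G k j.

Lemma gram_formC u v : gram_form u v = gram_form v u.
Proof.
rewrite /gram_form exchange_big; apply: eq_bigr => k _; apply: eq_bigr => j _.
by rewrite GC (mulrC (u j)).
Qed.

Lemma gram_formDZr u v b (s : R) :
  gram_form u (fun j => v j + s * b j) = gram_form u v + s * gram_form u b.
Proof.
rewrite /gram_form mulr_sumr -big_split; apply: eq_bigr => j _ /=.
rewrite mulr_sumr -big_split; apply: eq_bigr => k _ /=; ring.
Qed.

Lemma gram_form_line a u (s : R) :
  gram_form (fun j => a j + s * u j) (fun j => a j + s * u j) =
  gram_form a a + s * (2 * gram_form a u) + s ^+ 2 * gram_form u u.
Proof.
rewrite gram_formDZr (gram_formC _ a) (gram_formC _ u) !gram_formDZr.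
rewrite (gram_formC u a); ring.
Qed.

(** Common form of the two penalized risks, which differ only in [c]: the values [P_n h_j] or
    [P h_j]. *)
Definition entropic_quadratic c (eps : R) a : R :=
  gram_form a a - 2 * \sum_j a j * c j + eps * negentropy a.

Variables (c : 'I_N -> R) (eps : R) (a : 'I_N -> R).
Hypothesis eps0 : 0 < eps.
Hypothesis amin : argmin_on (simplex R N) (entropic_quadratic c eps) a.

Let a0 j : 0 <= a j. Proof. by case: amin => -[]. Qed.
Let a1 : \sum_j a j = 1. Proof. by case: amin => -[]. Qed.

Let line b (s : R) j : R := a j + s * (b j - a j).

Let line_ge0 b s j : simplex R N b -> 0 < s < 1 -> 0 <= line b s j.
Proof.
move=> [b0 _] /andP[s0 s1]; have := mulr_ge0 (ltW s0) (b0 j).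
have : 0 <= (1 - s) * a j by rewrite mulr_ge0// subr_ge0 ltW.
by rewrite /line; lra.
Qed.

Let line_simplex b s : simplex R N b -> 0 < s < 1 -> simplex R N (line b s).
Proof.
move=> bS s01; split=> [j|]; first exact: line_ge0.
by rewrite /line big_split/= -mulr_sumr sumrB a1 (proj2 bS) subrr mulr0 addr0.
Qed.

(** Derivative at [a], in the direction [b - a], of the risk without its entropy. *)
Let linear_part b : R := 2 * gram_form a (fun j => b j - a j) - 2 * \sum_j (b j - a j) * c j.

Let line_le b s : simplex R N b -> 0 < s < 1 ->
  0 <= s * linear_part b + s ^+ 2 * gram_form (fun j => b j - a j) (fun j => b j - a j)
       + eps * (negentropy (line b s) - negentropy a).
Proof.
move=> bS s01; have := proj2 amin _ (line_simplex bS s01).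
rewrite /entropic_quadratic gram_form_line /linear_part.
have -> : \sum_j line b s j * c j = \sum_j a j * c j + s * \sum_j (b j - a j) * c j.
  by rewrite mulr_sumr -big_split; apply: eq_bigr => j _ /=; rewrite /line; ring.
by lra.
Qed.

(* Moving mass [s] to a coordinate of [a] that vanishes changes the entropy by
   [s ln s], which beats every linear term. *)
Lemma entropic_argmin_gt0 i : 0 < a i.
Proof.
rewrite lt_neqAle a0 andbT; apply/negP => /eqP ai0.
pose b (j : 'I_N) : R := (j == i)%:R.
have bS : simplex R N b.
  split=> [j|]; first exact: ler0n.
  by rewrite (bigD1 i)//= /b eqxx big1 ?addr0// => j /negbTE ->.
set q1 := linear_part b; set q2 := gram_form (fun j => b j - a j) (fun j => b j - a j).
(* [K] exceeds all terms of order [s], and [s = exp (- K / eps)] makes the entropy gain [eps s ln s]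
   equal to [- K s], contradicting minimality. *)
pose K := `|q1| + `|q2| + eps * `|negentropy a| + 1.
have K0 : 0 < K by rewrite ltr_wpDl// !addr_ge0// mulr_ge0// ltW.
pose s := expR (- (K / eps)).
have s0 : 0 < s by exact: expR_gt0.
have s1 : s < 1 by rewrite -expR0 ltr_expR oppr_lt0 divr_gt0.
have s01 : 0 < s < 1 by rewrite s0 s1.
have ent_le : negentropy (line b s) <= (1 - s) * negentropy a + s * ln s.
  rewrite /negentropy (bigD1 i)//= [\sum_j a j * _](bigD1 i)//= -ai0 mul0r add0r.
  have -> : line b s i = s by rewrite /line /b eqxx -ai0 subr0 mulr1 add0r.
  rewrite addrC lerD2r mulr_sumr; apply: ler_sum => j ji.
  have -> : line b s j = (1 - s) * a j by rewrite /line /b (negbTE ji) mulr0n; ring.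
  have [->|aj] := eqVneq (a j) 0; first by rewrite !(mulr0, mul0r).
  have aj0 : 0 < a j by rewrite lt_neqAle eq_sym aj a0.
  have s1' : 0 < 1 - s by rewrite subr_gt0.
  rewrite -mulrA ler_wpM2l ?(ltW s1')// ler_wpM2l// lnM ?posrE//.
  by rewrite gerDr ln_le0// gerBl ltW.
have lns : eps * ln s = - K by rewrite /s expRK mulrN mulrC divfK ?gt_eqF.
have := line_le bS s01; rewrite -/q1 -/q2.
have : eps * (negentropy (line b s) - negentropy a) <= s * (- K - eps * negentropy a).
  have -> : s * (- K - eps * negentropy a) = eps * (s * ln s - s * negentropy a) by rewrite -lns; ring.
  by rewrite ler_pM2l//; lra.
have : s ^+ 2 * q2 <= s * `|q2|.
  rewrite expr2 -mulrA ler_pM2l// (le_trans (ler_wpM2l (ltW s0) (ler_norm q2)))//.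
  by rewrite ler_piMl// ltW.
have : 0 < s * (K - q1 - `|q2| + eps * negentropy a).
  rewrite mulr_gt0// /K; have := ler_norm q1.
  have : eps * (- negentropy a) <= eps * `|negentropy a| by rewrite ler_pM2l// -normrN ler_norm.
  by lra.
by lra.
Qed.

(** First-order optimality along the segment from [a] to [b]. Positivity of [a] makes the entropy
    differentiable there; the constant 1 in the derivative [ln t + 1] cancels because [b - a] sums
    to zero. *)
Lemma entropic_argmin_variational b : simplex R N b ->
  0 <= linear_part b + eps * \sum_j (b j - a j) * ln (a j).
Proof.
move=> bS.
apply: (@ge0_of_quadratic_ge0 _ _ (gram_form (fun j => b j - a j) (fun j => b j - a j) +
  eps * \sum_j (b j - a j) ^+ 2 / a j)) => s s01.
have := line_le bS s01.
have : negentropy (line b s) - negentropy a <=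
    s * \sum_j (b j - a j) * ln (a j) + s ^+ 2 * \sum_j (b j - a j) ^+ 2 / a j.
  have sum0 : \sum_j s * (b j - a j) = 0.
    by rewrite -mulr_sumr sumrB a1 (proj2 bS) subrr mulr0.
  rewrite -[leRHS]addr0 -[X in _ <= _ + X]sum0 !mulr_sumr -sumrB -!big_split.
  apply: ler_sum => j _ /=.
  apply: (le_trans (entropy_tangent_le (entropic_argmin_gt0 j) (line_ge0 j bS s01))).
  rewrite /line; have -> : a j + s * (b j - a j) - a j = s * (b j - a j) by ring.
  by rewrite exprMn; lra.
by move=> /(ler_wpM2l (ltW eps0)); lra.
Qed.

End EntropicQuadratic.

(** The optimality condition of [a] tested at [b] and that of [b] tested at [a] are added; the
    quadratic parts combine to [- 2 |f_(a - b)|^2], and halving leaves [eps / 2]. *)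
Lemma entropic_argmin_stability (R : realType) (N : nat) (G : 'I_N -> 'I_N -> R)
    (ca cb : 'I_N -> R) (eps : R) (a b : 'I_N -> R) :
  (forall j k, G j k = G k j) -> 0 < eps ->
  argmin_on (simplex R N) (entropic_quadratic G ca eps) a ->
  argmin_on (simplex R N) (entropic_quadratic G cb eps) b ->
  gram_form G (fun j => a j - b j) (fun j => a j - b j) +
    eps / 2 * \sum_j (a j - b j) * (ln (a j) - ln (b j)) <=
  \sum_j (a j - b j) * (ca j - cb j).
Proof.
move=> GC eps0 amin bmin.
have := entropic_argmin_variational GC eps0 amin (proj1 bmin).
have := entropic_argmin_variational GC eps0 bmin (proj1 amin).
have lin u v w : gram_form G u (fun j => v j - w j) = gram_form G u v - gram_form G u w.
  rewrite -mulN1r -gram_formDZr.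
  by congr gram_form; apply/funext => j; rewrite mulN1r.
have linl u v w : gram_form G (fun j => v j - w j) u = gram_form G v u - gram_form G w u.
  by rewrite !(gram_formC GC _ u) lin.
rewrite linl !lin (gram_formC GC b a).
have -> : \sum_j (a j - b j) * (ca j - cb j) =
    - \sum_j (b j - a j) * ca j - \sum_j (a j - b j) * cb j.
  by rewrite -sumrN -sumrB; apply: eq_bigr => j _; ring.
have -> : \sum_j (a j - b j) * (ln (a j) - ln (b j)) =
    - \sum_j (b j - a j) * ln (a j) - \sum_j (a j - b j) * ln (b j).
  by rewrite -sumrN -sumrB; apply: eq_bigr => j _; ring.
by lra.
Qed.

(** * The Gram matrix of the dictionary *)

Lemma ln2_ge_half (R : realType) : 1 / 2 <= ln 2 :> R.
Proof.
rewrite -(opprK (ln 2)) -lnV ?posrE//.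
have : ln (1 + - (1 / 2)) <= - (1 / 2) :> R by apply: le_ln1Dx; lra.
by rewrite (_ : 1 + - (1 / 2) = 2^-1); [lra|field].
Qed.

Section DensityGram.
Context (R : realType) d (S : measurableType d) (mu : {sigma_finite_measure set S -> \bar R}).
Context (N : nat) (h : 'I_N -> S -> R).
Hypotheses (hd : forall j, probability_density mu (h j)) (h1 : forall j x, h j x <= 1).

Let mh j : measurable_fun setT (h j). Proof. by case: (hd j). Qed.
Let h0 j x : 0 <= h j x. Proof. by case: (hd j). Qed.

Lemma Rintegral_sum_integrable I (s : seq I) (F : I -> S -> R) :
  (forall i, mu.-integrable setT (EFin \o F i)) ->
  mu.-integrable setT (EFin \o (fun x => \sum_(i <- s) F i x)) /\
  Rintegral mu setT (fun x => \sum_(i <- s) F i x) = \sum_(i <- s) Rintegral mu setT (F i).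
Proof.
move=> IF; elim: s => [|i s [ih1 ih2]].
  rewrite (_ : (fun x => _) = cst 0); last by apply/funext => x; rewrite big_nil.
  by rewrite big_nil Rintegral_cst// mul0r; split => //; exact: integrable0.
rewrite (_ : (fun x => _) = (fun x => F i x + \sum_(i <- s) F i x)); last first.
  by apply/funext => x; rewrite big_cons.
rewrite big_cons RintegralD// ih2; split => //.
by apply: eq_integrable (integrableD measurableT (IF i) ih1).
Qed.

Definition gram (j k : 'I_N) : R := Rintegral mu setT (fun x => h j x * h k x).

Lemma gramC j k : gram j k = gram k j.
Proof. by congr (Rintegral mu setT _); apply/funext => x; rewrite mulrC. Qed.

(** As [h k <= 1], the density [h j] is an integrable majorant. *)
Let integrable_hh j k : mu.-integrable setT (EFin \o (fun x => h j x * h k x)).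
Proof.
apply: (@le_integrable _ _ _ mu _ measurableT _ (EFin \o h j)) => //.
- by apply/measurable_EFinP/measurable_funM.
- move=> x _ /=; rewrite lee_fin !ger0_norm ?mulr_ge0//.
  by rewrite ler_piMr.
- apply/integrableP; split; first exact/measurable_EFinP.
  under eq_integral do rewrite gee0_abs ?lee_fin//.
  by case: (hd j) => _ _ ->; rewrite ltry.
Qed.

Lemma mixture_sqr_integral (v : 'I_N -> R) :
  mu.-integrable setT (EFin \o (fun x => mixture h v x ^+ 2)) /\
  Rintegral mu setT (fun x => mixture h v x ^+ 2) = gram_form gram v v.
Proof.
have -> : (fun x => mixture h v x ^+ 2) =
    (fun x => \sum_j \sum_k (v j * v k) * (h j x * h k x)).
  apply/funext => x; rewrite expr2 /mixture mulr_suml; apply: eq_bigr => j _.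
  by rewrite mulr_sumr; apply: eq_bigr => k _; ring.
have Ic j k : mu.-integrable setT (EFin \o (fun x => (v j * v k) * (h j x * h k x))).
  exact: eq_integrable (integrableZl measurableT (v j * v k) (integrable_hh j k)).
have [I1 ->] := Rintegral_sum_integrable (index_enum 'I_N)
  (fun j => proj1 (Rintegral_sum_integrable (index_enum 'I_N) (Ic j))).
split => //; apply: eq_bigr => j _.
rewrite (proj2 (Rintegral_sum_integrable (index_enum 'I_N) (Ic j))).
by apply: eq_bigr => k _; rewrite RintegralZl.
Qed.

(** Holds for every [f]: when the norm is infinite, [fine] sends both sides to 0. *)
Lemma L2norm_sqr (f : S -> R) : L2norm mu f ^+ 2 = Rintegral mu setT (fun x => f x ^+ 2).
Proof.
rewrite /L2norm /Rintegral.
have -> : (\int[mu]_x (f x ^+ 2)%:E = 'N[mu]_(2%:E)[EFin \o f] `^ 2)%E.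
  rewrite poweR_Lnorm//; apply: eq_integral => x _ /=.
  by rewrite powR_mulrn// real_normK// num_real.
case: ('N[mu]_(2%:E)[EFin \o f])%E (Lnorm_ge0 mu 2%:E (EFin \o f)) => [x|_|//] /=.
  by rewrite lee_fin => x0; rewrite powR_mulrn.
by rewrite pnatr_eq0 expr0n.
Qed.

Lemma L2norm_mixture (v : 'I_N -> R) : L2norm mu (mixture h v) ^+ 2 = gram_form gram v v.
Proof. by rewrite L2norm_sqr; case: (mixture_sqr_integral v). Qed.

Lemma mixtureB (a b : 'I_N -> R) :
  mixture h a \- mixture h b = mixture h (fun j => a j - b j).
Proof.
by apply/funext => x; rewrite /mixture /= -sumrB; apply: eq_bigr => j _; rewrite mulrBl.
Qed.

Lemma penalized_risk_entropic_quadratic (E : (S -> R) -> R) (c : 'I_N -> R) (eps : R) :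
  (forall v, E (mixture h v) = \sum_j v j * c j) ->
  penalized_risk mu h E eps = entropic_quadratic gram c eps.
Proof.
by move=> Ec; apply/funext => v; rewrite /penalized_risk L2norm_mixture Ec.
Qed.

(** The bound [fstar <= M] gives [P <= M mu] on measurable sets, which is transferred to the
    integral of [f_v^2]. *)
Lemma second_moment_le_gram (P : probability S R) (fstar : S -> R) (M : R) (v : 'I_N -> R) :
  has_density mu P fstar -> (forall x, fstar x <= M) -> 0 <= M ->
  second_moment P h v <= M * gram_form gram v v.
Proof.
move=> [[mf f0 _] Pf] fM M0; have [I2 G2] := mixture_sqr_integral v.
have bm : bounded_measurable (fun x => mixture h v x ^+ 2).
  by apply: bounded_measurableX; apply: bounded_measurable_mixture.
rewrite -lee_fin -G2 EFinM -(mean_EFin P bm) /Rintegral fineK; last first.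
  exact: integrable_fin_num.
have -> : (\int[P]_x (mixture h v x ^+ 2)%:E = \int[P]_x (1 * mixture h v x ^+ 2)%:E)%E.
  by under [RHS]eq_integral do rewrite mul1r.
apply: (le_integral_comp_weight (X := id) (Y := fun=> 1)) => //; last 2 first.
- by case: bm.
- by move=> x; exact: sqr_ge0.
- move=> B mB; under eq_integral do rewrite mul1r.
  rewrite integral_indic// setIT; apply: (le_trans (eq_ind_r (fun z => z <= _)%E (lexx _) (Pf B mB))).
  apply: (@le_trans _ _ (\int[mu]_(x in B) (cst M%:E) x)%E); last by rewrite integral_cst.
  apply: ge0_le_integral => //.
  + by move=> x _; rewrite lee_fin.
  + by apply/measurable_EFinP; exact: measurable_funTS.
  + by move=> x _; rewrite lee_fin.
Qed.

End DensityGram.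

(** * Symmetrized Kullback divergence of positive weights *)

Lemma symKL_gt0 (R : realType) (N : nat) (a b : 'I_N -> R) :
  (forall j, 0 < a j) -> (forall j, 0 < b j) ->
  symKL a b = (\sum_j (a j - b j) * (ln (a j) - ln (b j)))%:E.
Proof.
move=> a0 b0.
have KLE (l m : 'I_N -> R) : (forall j, 0 < l j) -> (forall j, 0 < m j) ->
    KL l m = (\sum_j l j * (ln (l j) - ln (m j)))%:E.
  move=> l0 m0; rewrite /KL -sumEFin; apply: eq_bigr => j _.
  by rewrite !gt_eqF// ln_div ?posrE.
rewrite /symKL !KLE// -EFinD -big_split; congr EFin; apply: eq_bigr => j _ /=; ring.
Qed.

(** Either [x <= 2 y] and the difference is at most [y], or [ln (x / y) >= ln 2 >= 1 / 2] and the
    entropy term dominates. *)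
Lemma normr_sub_le_symKL_term (R : realType) (x y : R) : 0 < x -> 0 < y ->
  `|x - y| <= y + 2 * ((x - y) * (ln x - ln y)).
Proof.
move=> x0 y0.
have mono : 0 <= (x - y) * (ln x - ln y).
  have [xy|yx] := leP x y.
    by rewrite mulr_le0 ?subr_le0// ler_ln ?posrE.
  by rewrite mulr_ge0 ?subr_ge0 ?ler_ln ?posrE// ltW.
have [x2y|y2x] := leP x (2 * y); first by rewrite ler_norml; lra.
have lnxy : 1 / 2 <= ln x - ln y.
  rewrite -ln_div ?posrE// (@le_trans _ _ (ln 2))//; last first.
    by rewrite ler_ln ?posrE ?divr_gt0// ler_pdivlMr// ltW.
  exact: ln2_ge_half.
rewrite gtr0_norm; last by lra.
have : (x - y) * (1 / 2) <= (x - y) * (ln x - ln y) by rewrite ler_wpM2l//; lra.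
by lra.
Qed.

(** * The uniform deviation bound and the oracle inequalities *)

(** The number of dyadic levels is of order [log n]; the growth condition makes it at most a power
    of [N]. *)
Lemma trunc_log_le_powR (R : realType) (gamma : R) (n N : nat) : 0 < gamma -> (0 < n)%N ->
  (ln n%:R) `^ gamma <= N%:R -> (trunc_log 2 n)%:R <= 2 * N%:R `^ gamma^-1.
Proof.
move=> g0 n0 nN; have n1 : 1 <= n%:R :> R by rewrite ler1n.
have ln_n0 : 0 <= ln (n%:R : R) by rewrite ln_ge0.
have le_pow : ln n%:R <= N%:R `^ gamma^-1.
  have -> : ln n%:R = ((ln n%:R) `^ gamma) `^ gamma^-1.
    by rewrite -powRrM mulfV ?gt_eqF// powRr1.
  by rewrite ge0_ler_powR ?nnegrE ?powR_ge0// invr_ge0 ltW.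
have /andP[tl _] := trunc_log_bounds (isT : (1 < 2)%N) n0.
have : (trunc_log 2 n)%:R * ln 2 <= ln n%:R :> R.
  rewrite mulr_natl -lnXn// ler_ln ?posrE ?exprn_gt0 ?ltr0n//.
  by rewrite -natrX ler_nat.
have := ler_wpM2l (ler0n R (trunc_log 2 n)) (ln2_ge_half R).
by lra.
Qed.

Lemma ln_union_bound_le (R : realType) (gamma A : R) (n N : nat) : 0 < gamma -> 1 <= A ->
  (0 < n)%N -> (1 < N)%N -> (ln n%:R) `^ gamma <= N%:R ->
  ln (N%:R `^ A * (2 * N + (trunc_log 2 n + 5).+1)%:R) <=
    (6 + gamma^-1) * (A * ln N%:R).
Proof.
move=> g0 A1 n0 N1 nN; have tl := trunc_log_le_powR g0 n0 nN.
set g := gamma^-1 in tl *; have gi0 : 0 < g by rewrite invr_gt0.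
have NR : 2 <= N%:R :> R by rewrite ler_nat.
have NR0 : 0 < N%:R :> R by lra.
have lnN : 0 <= ln N%:R :> R by rewrite ln_ge0//; lra.
have N_pow (x : R) : x <= 1 + g -> N%:R `^ x <= N%:R `^ (1 + g).
  by move=> xg; rewrite ler_powR//; lra.
(* The count is at most [(2 + 2 + 6) N^(1 + g)], and [N^4 >= 16] absorbs the numerical factor. *)
have sum_le : (2 * N + (trunc_log 2 n + 5).+1)%:R <= N%:R `^ (5 + g).
  have -> : 5 + g = 4 + (1 + g) by lra.
  rewrite powRD; last by rewrite (gt_eqF NR0) implybT.
  have -> : (2 * N + (trunc_log 2 n + 5).+1)%:R = 2 * N%:R + (trunc_log 2 n)%:R + 6 :> R.
    by rewrite -addnS natrD natrM natrD -addrA.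
  have p1 := N_pow 1; rewrite powRr1 in p1; last exact: ltW.
  have pg := N_pow g; have p0 := N_pow 0; rewrite powRr0 in p0.
  have -> : N%:R `^ 4 = N%:R ^+ 4 :> R by rewrite -powR_mulrn ?ltW.
  have N16 : 16 <= N%:R ^+ 4 :> R.
    by rewrite -[leLHS]/(16%:R) (_ : 16 = 2 ^ 4)%N// natrX lerXn2r// nnegrE ltW.
  have := ler_wpM2r (powR_ge0 N%:R (1 + g)) N16.
  have {}p1 := p1 ltac:(lra); have {}pg := pg ltac:(lra); have {}p0 := p0 ltac:(lra).
  by lra.
have T0 : 0 < N%:R `^ A :> R by rewrite powR_gt0.
have S0 : 0 < (2 * N + (trunc_log 2 n + 5).+1)%:R :> R by rewrite ltr0n addnS.
rewrite lnM ?posrE// ln_powR.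
have : ln (2 * N + (trunc_log 2 n + 5).+1)%:R <= ln (N%:R `^ (5 + g)) :> R.
  by rewrite ler_ln ?posrE// powR_gt0.
rewrite ln_powR; have : (5 + g) * ln N%:R <= (5 + g) * (A * ln N%:R).
  by rewrite ler_wpM2l//; [lra|rewrite ler_peMl].
by lra.
Qed.

Section EmpiricalProcess.
Context (R : realType) dO dS (Omega : measurableType dO) (S : measurableType dS).
Context (Pr : probability Omega R) (P : probability S R) (n N : nat).
Context (mu : {sigma_finite_measure set S -> \bar R}) (fstar : S -> R) (M : R).
Variables (X : 'I_n -> {mfun Omega >-> S}) (h : 'I_N -> S -> R).
Hypotheses (iidX : iid_sample Pr P X) (Pf : has_density mu P fstar).
Hypotheses (fM : forall x, fstar x <= M) (M1 : 1 <= M).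
Hypotheses (hd : forall j, probability_density mu (h j)) (h1 : forall j x, h j x <= 1).
Hypotheses (n_gt0 : (0 < n)%N) (N_gt1 : (1 < N)%N).

Let mh j : measurable_fun setT (h j). Proof. by case: (hd j). Qed.
Let h0 j x : 0 <= h j x. Proof. by case: (hd j). Qed.

Lemma deviation_event (gamma A : R) (J : {set 'I_N}) :
  0 < gamma -> 1 <= A -> (ln n%:R) `^ gamma <= N%:R ->
  let r := (#|J|%:R + A * ln N%:R) / n%:R in
  let K := 400 * (6 + gamma^-1) in
  holds_with_prob_ge Pr (1 - N%:R `^ (- A)) (fun w => forall u : 'I_N -> R,
    \sum_j `|u j| <= 2 ->
    \sum_j u j * deviation P X h w j <=
      2 * K * Num.sqrt r * \sum_(j | j \notin J) `|u j| +
      gram_form (gram mu h) u u / 2 + K ^+ 2 * (M ^+ 2 * r)).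
Proof.
move=> g0 A1 nN r K; pose kappa := 6 + gamma^-1; have KE : K = 400 * kappa by [].
have nR0 : 0 < n%:R :> R by rewrite ltr0n.
have NR : 2 <= N%:R :> R by rewrite ler_nat.
have lnN : 1 / 2 <= ln N%:R :> R.
  by rewrite (le_trans (ln2_ge_half R))// ler_ln ?posrE//; lra.
have AlnN : ln N%:R <= A * ln N%:R by rewrite ler_peMl//; lra.
have nrE : n%:R * r = #|J|%:R + A * ln N%:R by rewrite /r mulrC divfK ?gt_eqF.
have d0 : 0 <= #|J|%:R :> R by [].
have r0 : 0 < r by rewrite divr_gt0//; lra.
have kappa6 : 6 <= kappa by rewrite lerDl invr_ge0 ltW.
have lnTn := ln_union_bound_le g0 A1 n_gt0 N_gt1 nN; rewrite -/kappa in lnTn.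
clearbody kappa K r.
have K1 : 2 <= K by rewrite KE; lra.
have KK : K <= K ^+ 2 by rewrite expr2 ler_peMl//; lra.
have M_ge1 : 1 <= M by [].
have M0 : 0 <= M by lra.
have MM : M <= M ^+ 2 by rewrite expr2 ler_peMl.
have gram_ge0 u : 0 <= gram_form (gram mu h) u u by rewrite -L2norm_mixture// sqr_ge0.
have sr0 : 0 < Num.sqrt r by rewrite sqrtr_gt0.
have srE : Num.sqrt r ^+ 2 = r by rewrite sqr_sqrtr// ltW.
have rM : r <= M ^+ 2 * r by rewrite ler_peMl ?(ltW r0)//; lra.
have rM' : M * r <= M ^+ 2 * r by rewrite ler_pM2r.
have Delta_ge0 (u : 'I_N -> R) : 0 <= \sum_(j | j \notin J) `|u j| by exact: sumr_ge0.
(* For [r >= 1] the bound is deterministic: the left side is at most [|u|_1 <= 2], and [K^2 M^2 r]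
   is at least 2. *)
have [r1|r1] := leP 1 r.
  exists setT; split => //.
    by rewrite probability_setT lee_fin gerBl powR_ge0.
  move=> w _ u u2.
  have : \sum_j u j * deviation P X h w j <= \sum_j `|u j|.
    apply: ler_sum => j _; rewrite (le_trans (ler_norm _))// normrM ler_piMr//.
    exact: normr_deviation_le1.
  have := mulr_ge0 (mulr_ge0 (_ : 0 <= 2 * K) (ltW sr0)) (Delta_ge0 u).
  move=> /(_ ltac:(lra)); have := gram_ge0 u.
  have : 2 * 1 <= K ^+ 2 * (M ^+ 2 * r) by rewrite ler_pM//; lra.
  by lra.
(* [L] ensures [4^L >= 64 n], hence [4^L r >= 64 ln N >= 32]; [q] makes the total rounding error
   [N / q] at most [r]. *)
pose L := (trunc_log 2 n + 5)%N; pose q := (Num.bound (N%:R / r)).+1.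
have Nq : N%:R <= q%:R * r.
  rewrite -ler_pdivrMr// ltW// (lt_le_trans (archi_boundP _))//.
    by rewrite divr_ge0// ltW.
  by rewrite ler_nat.
have Lr : 20 <= 4 ^+ L * r.
  have nL : 64 * n%:R <= 4 ^+ L :> R.
    have /andP[_ nl] := trunc_log_bounds (isT : (1 < 2)%N) n_gt0.
    rewrite -natrM -natrX ler_nat (_ : 4 = 2 ^ 2)%N// -expnM.
    apply: (@leq_trans (2 ^ 6 * 2 ^ (trunc_log 2 n).+1)%N).
      by rewrite leq_mul2l ltnW.
    by rewrite -expnD leq_exp2l// /L; move: (trunc_log 2 n) => t; clear; lia.
  have : 64 * n%:R * r <= 4 ^+ L * r by rewrite ler_pM2r.
  by rewrite -mulrA nrE; lra.
have T0 : 0 < N%:R `^ A :> R by rewrite powR_gt0//; lra.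
have Jr : #|J|%:R <= n%:R * r by rewrite nrE; lra.
have lnT : ln (N%:R `^ A * (2 * N + L.+1)%:R) <= kappa * (n%:R * r).
  rewrite (le_trans lnTn)// ler_wpM2l//; first by lra.
  by rewrite nrE; lra.
have kappa1 : 1 <= kappa by lra.
have [E [mE PE EP]] := uniform_deviation_event iidX mh h0 h1 n_gt0 (J := J)
  (ltn0Sn _ : (0 < q)%N) r0 r1 kappa1 T0 Jr lnT.
exists E; split => //; first by rewrite powRN.
move=> w /EP[dev_h dev_lat] u u2.
(* The part [v] on [J] is treated by the lattice bound, the part [v'] off [J] coordinate by
   coordinate. *)
pose v j := if j \in J then u j else 0; pose v' j := if j \in J then 0 else u j.
set Delta := \sum_(j | j \notin J) _; set Guu := gram_form _ u u.
have uE : u = (fun j => v j + v' j).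
  by apply/funext => j; rewrite /v /v'; case: ifP; rewrite ?addr0 ?add0r.
have vE : v = (fun j => u j + - v' j).
  by apply/funext => j; rewrite /v /v'; case: ifP; rewrite ?oppr0 ?addr0 ?subrr.
have v'1 : \sum_j `|v' j| = Delta.
  rewrite /Delta [RHS]big_mkcond; apply: eq_bigr => j _.
  by rewrite /v'; case: ifP; rewrite ?normr0.
have v1 : \sum_j `|v j| <= 2.
  rewrite (le_trans _ u2)// ler_sum// => j _; rewrite /v; case: ifP => //.
  by rewrite normr0.
have Delta0 : 0 <= Delta by exact: Delta_ge0.
have G0 : 0 <= Guu by exact: gram_ge0.
(* Bound for the L2(P) norm of [f_v = f_u - f_v']: the two norms are at most [sqrt M |f_u|] in
   L2(mu) and [|v'|_1 = Delta]. *)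
pose s := 2 * (Num.sqrt M * Num.sqrt Guu + Delta).
have sM : Num.sqrt M ^+ 2 = M by rewrite sqr_sqrtr//; lra.
have sG : Num.sqrt Guu ^+ 2 = Guu by rewrite sqr_sqrtr.
have MG0 : 0 <= Num.sqrt M * Num.sqrt Guu by rewrite mulr_ge0 ?sqrtr_ge0.
have s0 : 0 <= s by rewrite mulr_ge0// addr_ge0.
have vs : second_moment P h v <= s ^+ 2.
  rewrite vE (le_trans (second_momentD_le P mh h0 h1 _ _))//.
  have : second_moment P h (fun j => - v' j) <= Delta ^+ 2.
    apply: second_moment_le => //.
    by rewrite -v'1 le_eqVlt (eq_bigr (fun j => `|v' j|)) ?eqxx// => j _; rewrite normrN.
  have : second_moment P h u <= M * Guu.
    by apply: (second_moment_le_gram hd h1 _ Pf fM); lra.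
  have -> : s ^+ 2 = 4 * (Num.sqrt M ^+ 2 * Num.sqrt Guu ^+ 2 + Delta ^+ 2) +
    8 * (Num.sqrt M * Num.sqrt Guu * Delta) by rewrite /s; ring.
  rewrite sM sG; have : 0 <= Num.sqrt M * Num.sqrt Guu * Delta by rewrite mulr_ge0.
  have : 0 <= M * Guu by rewrite mulr_ge0//; lra.
  by have := sqr_ge0 Delta; lra.
have vJ j : j \notin J -> v j = 0 by rewrite /v => /negbTE ->.
have devJ := deviation_le_of_lattice mh h0 h1 n_gt0 r0 r1 kappa1 Nq (ltn0Sn _) Lr dev_lat
  vJ v1 s0 vs.
have devJc : \sum_j v' j * deviation P X h w j <= 17 * kappa * Num.sqrt r * Delta.
  rewrite -v'1 mulr_sumr; apply: ler_sum => j _; rewrite (le_trans (ler_norm _))//.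
  by rewrite normrM mulrC ler_wpM2r.
have -> : \sum_j u j * deviation P X h w j =
    \sum_j v j * deviation P X h w j + \sum_j v' j * deviation P X h w j.
  by rewrite -big_split; apply: eq_bigr => j _ /=; rewrite [in LHS]uE mulrDl.
(* AM-GM for the cross term [K sqrt (M r) |f_u|]. *)
have amgm : K * (Num.sqrt r * (Num.sqrt M * Num.sqrt Guu)) <= Guu / 2 + K ^+ 2 * (M * r) / 2.
  have := sqr_ge0 (Num.sqrt Guu - K * Num.sqrt r * Num.sqrt M).
  have -> : (Num.sqrt Guu - K * Num.sqrt r * Num.sqrt M) ^+ 2 =
    Num.sqrt Guu ^+ 2 + K ^+ 2 * (Num.sqrt M ^+ 2 * Num.sqrt r ^+ 2) -
    2 * (K * (Num.sqrt r * (Num.sqrt M * Num.sqrt Guu))) by ring.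
  by rewrite sM sG srE; lra.
have KMr : K ^+ 2 * (M * r) <= K ^+ 2 * (M ^+ 2 * r) by rewrite ler_wpM2l ?sqr_ge0.
have Kr : K * r <= K ^+ 2 * (M ^+ 2 * r) by rewrite ler_pM// ?(ltW r0)//; lra.
have sD0 : 0 <= kappa * Num.sqrt r * Delta by rewrite !mulr_ge0 ?sqrtr_ge0//; lra.
have devJc_le : 17 * kappa * Num.sqrt r * Delta <= K * Num.sqrt r * Delta.
  by rewrite KE; lra.
move: devJ; rewrite (_ : 200 * kappa * (Num.sqrt r * s + r) =
  K * (Num.sqrt r * (Num.sqrt M * Num.sqrt Guu)) + K * Num.sqrt r * Delta + K * r / 2).
  by lra.
by rewrite KE /s; field.
Qed.

End EmpiricalProcess.

(** The closing arithmetic: [sr] stands for [sqrt r], [X] for [M^2 sqrt r], [G] for [|f_u|^2], [Q]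
    for the symmetrized divergence, [Da] and [Db] for the two masses off [J], and [Delta] for the l1
    distance off [J]. *)
Lemma oracle_bounds (R : realType) (K eps sr X G Q Da Db Delta : R) :
  2 <= K -> 0 < sr -> 16 * K * sr <= eps -> 0 <= X -> 0 <= G -> 0 <= Q -> 0 <= Da -> 0 <= Db ->
  Delta <= Da + 2 * Q -> Delta <= Db + 2 * Q -> Da <= Db + Delta -> Db <= Da + Delta ->
  G + eps / 2 * Q <= 2 * K * sr * Delta + G / 2 + K ^+ 2 * (X * sr) ->
  let C := 4 * (2 * K + K ^+ 2) in
  [/\ Da <= C * (Db + X), Db <= C * (Da + X) & G + eps * Q <= C * Num.max (X * sr) (Db * sr)].
Proof.
move=> K2 sr0 D_eps X0 G0 Q0 Da0 Db0 DeltaA DeltaB DaDb DbDa main C.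
have Ksr : 0 < 2 * K * sr by rewrite !mulr_gt0//; lra.
have KK : K <= K ^+ 2 by rewrite expr2 ler_peMl//; lra.
have epsQ : 16 * K * sr * Q <= eps * Q by rewrite ler_wpM2r.
(* Since [eps >= 16 K sr], the term [4 K sr Q] is at most [eps Q / 4] and is absorbed on the left.
   The statement is needed for both masses [Da] and [Db]. *)
have bound D : 0 <= D -> Delta <= D + 2 * Q ->
    G / 2 + eps * Q / 4 <= 2 * K * (sr * D) + K ^+ 2 * (X * sr) /\ 2 * Q <= D + K ^+ 2 * X.
  move=> D0 DeltaD; have := ler_wpM2l (ltW Ksr) DeltaD => le1.
  have {}le1 : G / 2 + eps * Q / 4 <= 2 * K * (sr * D) + K ^+ 2 * (X * sr) by lra.
  split => //; rewrite -(ler_pM2l Ksr).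
  have : K ^+ 2 * (X * sr) * 1 <= K ^+ 2 * (X * sr) * (2 * K).
    by rewrite ler_wpM2l// ?mulr_ge0 ?sqr_ge0 ?(ltW sr0)//; lra.
  by lra.
(* One mass is at most the other, [D], plus [Delta], hence at most [2 D + 2 Q], and
   [2 Q <= D + K^2 X]; this gives [3 D]. *)
have CE (D : R) : 0 <= D -> 3 * D + K ^+ 2 * X <= C * (D + X).
  move=> D0; have : 2 * X <= K * X by rewrite ler_wpM2r.
  have : K * X <= K ^+ 2 * X by rewrite ler_wpM2r.
  have : 2 * D <= K * D by rewrite ler_wpM2r.
  have : K * D <= K ^+ 2 * D by rewrite ler_wpM2r.
  by rewrite /C; lra.
have [boundA QA] := bound _ Da0 DeltaA; have [boundB QB] := bound _ Db0 DeltaB.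
split.
- by have := CE _ Db0; lra.
- by have := CE _ Da0; lra.
- have K0 : 0 <= K by lra.
  have := ler_wpM2l K0 (_ : Db * sr <= Num.max (X * sr) (Db * sr)).
  rewrite le_max lexx orbT => /(_ isT).
  have := ler_wpM2l (sqr_ge0 K) (_ : X * sr <= Num.max (X * sr) (Db * sr)).
  rewrite le_max lexx => /(_ isT).
  by rewrite /C; lra.
Qed.

Theorem theorem5 (R : realType) (gamma : R) (gamma_gt0 : 0 < gamma) :
  exists D C : R, [/\ 0 < D, 0 < C &
  forall (dO dS : measure_display)
    (Omega : measurableType dO) (Pr : probability Omega R)
    (S : measurableType dS) (mu : {sigma_finite_measure set S -> \bar R})
    (P : probability S R) (fstar : S -> R) (M : R)
    (N : nat) (h : 'I_N -> S -> R)
    (n : nat) (X : 'I_n -> {mfun Omega >-> S}),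
  has_density mu P fstar ->
  (forall x, fstar x <= M) ->
  1 <= M ->
  (forall j, probability_density mu (h j)) ->
  (forall j x, h j x <= 1) ->
  (0 < N)%N -> (0 < n)%N ->
  (ln n%:R) `^ gamma <= N%:R ->
  iid_sample Pr P X ->
  forall (J : {set 'I_N}) (A eps : R),
  let r := (#|J|%:R + A * ln N%:R) / n%:R in
  1 <= A ->
  D * Num.sqrt r <= eps ->
  forall (lhat : Omega -> 'I_N -> R) (leps : 'I_N -> R),
  (forall w, argmin_on (simplex R N)
               (penalized_risk mu h (empirical_mean X w) eps) (lhat w)) ->
  argmin_on (simplex R N)
    (penalized_risk mu h (mean P) eps) leps ->
  holds_with_prob_ge Pr (1 - N%:R `^ (- A)) (fun w =>
    [/\ \sum_(j | j \notin J) lhat w j <=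
          C * (\sum_(j | j \notin J) leps j + M ^+ 2 * Num.sqrt r),
        \sum_(j | j \notin J) leps j <=
          C * (\sum_(j | j \notin J) lhat w j + M ^+ 2 * Num.sqrt r)
      & ((L2norm mu (mixture h (lhat w) \- mixture h leps) ^+ 2)%:E
           + eps%:E * symKL (lhat w) leps <=
         (C * Num.max (M ^+ 2 * r)
                ((\sum_(j | j \notin J) leps j) * Num.sqrt r))%:E)%E])].
Proof.
pose K : R := 400 * (6 + gamma^-1).
have gi0 : 0 < gamma^-1 by rewrite invr_gt0.
have K2 : 2 <= K by rewrite /K; lra.
have D0 : 0 < 16 * K by lra.
exists (16 * K), (4 * (2 * K + K ^+ 2)); split => //.
- by rewrite mulr_gt0// ltr_wpDr ?sqr_ge0//; lra.
move=> dO dS Omega Pr S mu P fstar M N h n X Pf fM M1 hd h1 N0 n0 nN iidX J A eps r A1 D_eps.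
move=> lhat leps lhat_min leps_min.
(* For [N = 1] the required probability is 0 and the empty event suffices; from then on [ln N > 0],
   so [r] and [eps] are positive. *)
have [N1|N1] := leqP N 1.
  have {N0 N1} N1 : N%:R = 1 :> R by apply/eqP; rewrite pnatr_eq1 eqn_leq N1.
  by exists set0; split => //; rewrite N1 powR1 subrr measure0.
have [E [mE PE EP]] := deviation_event iidX Pf fM M1 hd h1 n0 N1 J gamma_gt0 A1 nN.
exists E; split => // w /EP; rewrite -/K -/r => dev_le.
have mh j : measurable_fun setT (h j) by case: (hd j).
have h0 j x : 0 <= h j x by case: (hd j).
have lnN : 1 / 2 <= ln N%:R :> R.
  by rewrite (le_trans (ln2_ge_half R))// ler_ln ?posrE ?ltr0n ?ler_nat// ltnW.
have r0 : 0 < r.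
  rewrite divr_gt0 ?ltr0n// ltr_wpDl// mulr_gt0//; first exact: lt_le_trans A1.
  by apply: lt_le_trans lnN.
have sr0 : 0 < Num.sqrt r by rewrite sqrtr_gt0.
have eps0 : 0 < eps := lt_le_trans (mulr_gt0 D0 sr0) D_eps.
set a := lhat w; set b := leps.
have amin : argmin_on (simplex R N)
    (entropic_quadratic (gram mu h) (fun j => empirical_mean X w (h j)) eps) a.
  rewrite -(penalized_risk_entropic_quadratic hd h1 (E := empirical_mean X w))//.
  exact: empirical_mean_mixture.
have bmin : argmin_on (simplex R N)
    (entropic_quadratic (gram mu h) (fun j => mean P (h j)) eps) b.
  rewrite -(penalized_risk_entropic_quadratic hd h1 (E := mean P))//.
  exact: mean_mixture.
have gC := @gramC _ _ _ mu _ h.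
have a_gt0 := entropic_argmin_gt0 gC eps0 amin.
have b_gt0 := entropic_argmin_gt0 gC eps0 bmin.
have stab := entropic_argmin_stability gC eps0 amin bmin.
have [[[_ a1] _] [[_ b1] _]] := (amin, bmin).
pose u j := a j - b j.
have u2 : \sum_j `|u j| <= 2.
  rewrite (_ : 2 = \sum_j (a j + b j)); last by rewrite big_split/= a1 b1.
  apply: ler_sum => j _; rewrite (le_trans (ler_normB _ _))//.
  by rewrite !gtr0_norm.
have := le_trans stab (dev_le u u2); rewrite -/u.
rewrite mixtureB L2norm_mixture// symKL_gt0// -EFinM -EFinD lee_fin.
set Q := \sum_j _; set Delta := \sum_(j | j \notin J) _; set G := gram_form _ _ _ => main.
have term0 j : 0 <= (a j - b j) * (ln (a j) - ln (b j)).
  have [ab|ba] := leP (a j) (b j).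
    by rewrite mulr_le0 ?subr_le0// ler_ln ?posrE.
  by rewrite mulr_ge0 ?subr_ge0 ?ler_ln ?posrE// ltW.
have Q_ge : \sum_(j | j \notin J) (a j - b j) * (ln (a j) - ln (b j)) <= Q.
  by rewrite /Q [leRHS](bigID (fun j => j \notin J))/= lerDl sumr_ge0.
have Q0 : 0 <= Q by exact: sumr_ge0.
have r_sqr : M ^+ 2 * r = M ^+ 2 * Num.sqrt r * Num.sqrt r.
  by rewrite -mulrA -expr2 sqr_sqrtr// ltW.
rewrite r_sqr in main *.
apply: (oracle_bounds (Delta := Delta) K2 sr0 D_eps) => //.
- by rewrite mulr_ge0 ?sqr_ge0// ltW.
- by rewrite /G -L2norm_mixture// sqr_ge0.
- by apply: sumr_ge0 => j _; exact: ltW.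
- by apply: sumr_ge0 => j _; exact: ltW.
(* The divergence terms are symmetric in [a] and [b], so the same scalar inequality also serves with
   the roles exchanged. *)
- rewrite (le_trans _ (lerD (lexx _) (ler_wpM2l _ Q_ge)))// mulr_sumr -big_split.
  apply: ler_sum => j _ /=; rewrite /u distrC (le_trans (normr_sub_le_symKL_term _ _))//.
  by rewrite -[(b j - a j) * _]mulrNN !opprB.
- rewrite (le_trans _ (lerD (lexx _) (ler_wpM2l _ Q_ge)))// mulr_sumr -big_split.
  by apply: ler_sum => j _; exact: normr_sub_le_symKL_term.
- rewrite -big_split; apply: ler_sum => j _ /=; rewrite -lerBlDl; exact: ler_norm.
- rewrite -big_split; apply: ler_sum => j _ /=; rewrite -lerBlDl /u distrC; exact: ler_norm.
Qed.
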